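(* If $\mathcal G$ is a semifilter on $\omega$ that is a $G_\delta$ subset of $2^\omega$, then $\mathfrak p_{\mathcal G}=\mathfrak t_{\mathcal G}=\mathfrak p$.
   Context: For $A,B\subseteq\omega$, $A\subseteq^* B$ means $A\setminus B$ is finite. A semifilter on $\omega$ is a set $\mathcal S\subseteq\mathcal P(\omega)$ with $\emptyset\neq\mathcal S\neq\mathcal P(\omega)$ closed upwards under $\subseteq^*$; subsets of $\omega$ are identified with points of $2^\omega$ (product topology). For a semifilter $\mathcal S$ (ordered by $\subseteq^*$): a family $\mathcal H\subseteq\mathcal S$ is centered if every finite subfamily has a lower bound in $\mathcal S$, and unbounded if there is no $A\in\mathcal S$ with $A\subseteq^* H$ for all $H\in\mathcal H$. $\mathfrak p_{\mathcal S}$ is the least size of an unbounded centered subset of $\mathcal S$, and $\mathfrak t_{\mathcal S}$ is the least size of an unbounded $\subseteq^*$-chain in $\mathcal S$. $\mathfrak p$ is the pseudo-intersection number (equal to $\mathfrak p_{[\omega]^\omega}$, with $[\omega]^\omega$ the set of infinite subsets of $\omega$). *)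

(* Defs.v *)
From mathcomp Require Import all_boot.
From mathcomp Require Import boolp classical_sets functions cardinality.
From mathcomp Require Import topology borel_hierarchy cantor.

Set Implicit Arguments.
Unset Strict Implicit.
Unset Printing Implicit Defensive.

Local Open Scope classical_set_scope.
Local Open Scope card_scope.

Definition almost_subset (A B : set nat) : Prop := finite_set (A `\` B).

Notation "A `<=* B" := (almost_subset A B) (at level 70, no associativity)
  : classical_set_scope.

Definition semifilter (S : set (set nat)) : Prop :=
  [/\ S !=set0, S <> setT & forall A B, S A -> A `<=* B -> S B].

(* the set of points of 2^omega which corresponds to a family of subsets of
   omega, a point x being identified with the subset {n | x n} *)
Definition cantor_of (S : set (set nat)) : set cantor_space :=
  [set x | S [set n | x n]].

Definition lower_bound_of (H : set (set nat)) (A : set nat) : Prop :=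
  forall B, H B -> A `<=* B.

Definition centered (S H : set (set nat)) : Prop :=
  H `<=` S /\
  forall F, finite_set F -> F `<=` H -> exists2 A, S A & lower_bound_of F A.

Definition almost_chain (S H : set (set nat)) : Prop :=
  H `<=` S /\ forall A B, H A -> H B -> A `<=* B \/ B `<=* A.

Definition unbounded (S H : set (set nat)) : Prop :=
  ~ exists2 A, S A & lower_bound_of H A.

(* Cardinal numbers are represented by arbitrary sets, taken up to
   equipotence [#=]: the relation below says that K is a representative of
   the least size of a family with property P.  It entails that there are
   families with property P. *)
Definition least_size (T U : Type) (P : set T -> Prop) (K : set U) : Prop :=
  (exists2 H, P H & H #= K) /\ forall H, P H -> K #<= H.

Definition p_number (U : Type) (S : set (set nat)) (K : set U) : Prop :=
  least_size (fun H => centered S H /\ unbounded S H) K.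

Definition t_number (U : Type) (S : set (set nat)) (K : set U) : Prop :=
  least_size (fun H => almost_chain S H /\ unbounded S H) K.

Definition strong_fip (H : set (set nat)) : Prop :=
  forall F, finite_set F -> F `<=` H -> infinite_set (\bigcap_(B in F) B).

(* p itself: the least size of a family with the strong finite intersection
   property and without infinite pseudo-intersection *)
Definition pseudo_intersection_number (U : Type) (K : set U) : Prop :=
  least_size (fun H => strong_fip H /\
    ~ exists2 A, infinite_set A & lower_bound_of H A) K.

(* Main.v *)
Require Import Defs.
From mathcomp Require Import all_boot.
From mathcomp Require Import boolp classical_sets functions cardinality.
From mathcomp Require Import topology borel_hierarchy cantor.
From mathcomp Require Import wochoice.

Set Implicit Arguments.
Unset Strict Implicit.
Unset Printing Implicit Defensive.

Local Open Scope classical_set_scope.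
Local Open Scope card_scope.

(* Let W be a well-order of type p, and suppose that every tower of length W in
   ([omega]^omega, almost inclusion) has a pseudo-intersection. Then W-sequences
   of functions can be built on a descending sequence of infinite sets, as in a
   generic ultrapower, and this refutes the existence of a family (h_w) with the
   strong finite intersection property and no pseudo-intersection, so p = t.
   Fix an increasing sequence (b_w) of functions and build sequences s_n with
   s_n(e) in h_v for b_v(n) <= e < b_w(n). A function between all b_w and all
   maximal lengths up to which this goes on, v in W, would select a
   pseudo-intersection, so the gap which they form has to be filled. Gaps with
   upper side of size p are filled by an upper bound of nested intervals. If the
   upper side (a_j) has a smaller cardinality kappa, code by points p_g, for
   g < kappa^+, injections of the predecessors of g into kappa, and build
   sequences of finite sets of points such that p_g belongs to the sets from
   index b_g on and the points of the e-th set code only values a_j >= e. If the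
   gap is not filled, each g survives in these sets beyond some a_j;
     by the coded
   inequalities, the g < kappa^+ with the same j are at most kappa many,
   which is impossible.
   A G_delta semifilter is described by families A_k of finite sets: the members
   of G contain elements of each A_k arbitrarily far out,
     and a set which contains
   elements of infinitely many A_k is in G. Choosing such elements by saturation
   gives p <= p_G, and a disjoint choice a_n in A_n maps an unbounded tower
     (X_w)
   to the unbounded chain of the unions of the a_n with n in X_w. *)

(** * Comparison of cardinalities by injections *)

Lemma card_le_injP (T U : Type) (A : set T) (B : set U) :
  (exists f : T -> U, (forall x, A x -> B (f x)) /\
    (forall x y, A x -> A y -> f x = f y -> x = y)) -> A #<= B.
Proof.
case=> f [fAB finj]; have [] // := (@injfunPex _ _ A B).2.
  by exists f => // x y; rewrite !inE => Ax Ay; exact: finj.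
by move=> g; exact: inj_card_le.
Qed.

Lemma card_le_inj (T U : Type) (u : U) (A : set T) (B : set U) : A #<= B ->
  exists f : T -> U, (forall x, A x -> B (f x)) /\
    (forall x y, A x -> A y -> f x = f y -> x = y).
Proof.
elim/Ppointed: U => U in u B *; first by case: (no u).
move=> /pcard_leP[f]; exists f; split=> [x Ax|x y Ax Ay]; first exact: 'funS_f.
by apply: 'inj_f; rewrite inE.
Qed.

Lemma card_leX (T U T' U' : Type) (A : set T) (A' : set T') (B : set U)
    (B' : set U') : A #<= A' -> B #<= B' -> A `*` B #<= A' `*` B'.
Proof.
move=> AA' BB'.
have [[[a b] [/= Aa Bb]]|ne] := pselect (A `*` B !=set0); last first.
  suff -> : A `*` B = set0 by [].
  by apply/seteqP; split=> // x ABx; case: ne; exists x.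
have [a'|nA'] := pselect (inhabited T'); last first.
  have A'0 : A' = set0 by apply/seteqP; split=> // x _; case: nA'; exists.
  by move: AA'; rewrite A'0 => /card_le0P A0; move: Aa; rewrite A0.
have [b'|nB'] := pselect (inhabited U'); last first.
  have B'0 : B' = set0 by apply/seteqP; split=> // x _; case: nB'; exists.
  by move: BB'; rewrite B'0 => /card_le0P A0; move: Bb; rewrite A0.
case: a' b' => a' [b'].
have [f [fA finj]] := card_le_inj a' AA'.
have [g [gA ginj]] := card_le_inj b' BB'.
apply: card_le_injP; exists (fun p => (f p.1, g p.2)); split.
  by move=> x [? ?]; split; [exact: fA|exact: gA].
by move=> [x y] [z t] [/= ? ?] [/= ? ?] [/finj -> // /ginj ->].
Qed.

(** A Hilbert hotel along a sequence [g] in [A]: [g n] moves to [g n.*2], and the points of [C]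
    outside [A] take the odd places. *)
Lemma infinite_setU_countable (T : Type) (A C : set T) :
  infinite_set A -> countable C -> A `|` C #<= A.
Proof.
move=> infA cC; have [a Aa] := infinite_setN0 infA.
have /(card_le_inj a)[g [gA ginj]] := (infiniteP A).1 infA.
have [h [_ hinj]] := card_le_inj 0 cC.
pose inv x := if pselect (exists n,
  g n = x) is left e then Some (projT1 (cid e))
  else None.
have invP x n : inv x = Some n -> g n = x.
  by rewrite /inv; case: pselect => // e [<-]; case: cid.
have invN x n : inv x = None -> g n <> x.
  by rewrite /inv; case: pselect => // e _ ?; apply: e; exists n.
apply: card_le_injP.
exists (fun x => if pselect (A x) then
    (if inv x is Some n then g n.*2 else x) else g (h x).*2.+1); split.
  move=> x [Ax|Cx]; case: pselect => // Ax'; first by case: (inv x) => // n;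
    exact: gA.
    by case: (inv x) => // n; exact: gA.
  exact: gA.
have par n m : n.*2 = m.*2.+1 -> False.
  by move/(congr1 odd); rewrite /= !odd_double.
move=> x y xAC yAC; case: pselect => Ax; case: pselect => Ay.
- case ix : (inv x) => [n|]; case iy : (inv y) => [m|] //.
  + move/ginj => /(_ I I)/double_inj nm.
    by rewrite -(invP _ _ ix) -(invP _ _ iy) nm.
  + by move=> e; case: (invN _ n.*2 iy).
  + by move=> /esym e; case: (invN _ m.*2 ix).
- case ix : (inv x) => [n|].
    by move/ginj => /(_ I I)/par.
  by move=> /esym/invN-/(_ ix).
- case iy : (inv y) => [n|].
    by move/ginj => /(_ I I)/esym/par.
  by move/invN => /(_ iy).
- move/ginj => /(_ I I)[]/double_inj/hinj; apply.
    by case: xAC.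
  by case: yAC.
Qed.

(** * Well-orders: recursion, comparison, squares *)

Definition strict_wo (W : Type) (lt : W -> W -> Prop) : Prop :=
  well_founded lt /\ forall x y, [\/ lt x y, x = y | lt y x].

Section StrictWellOrder.
Context (W : Type) (lt : W -> W -> Prop) (ltwo : strict_wo lt).
Let lt_wf : well_founded lt := ltwo.1.
Let lt_tri : forall x y, [\/ lt x y, x = y | lt y x] := ltwo.2.

Definition seg (w : W) : set W := [set v | lt v w].

Lemma wo_min (D : set W) : D !=set0 -> exists2 m, D m & forall x,
  lt x m -> ~ D x.
Proof.
case=> x; elim/(well_founded_ind lt_wf): x => x IH Dx.
have [[y lyx Dy]|nex] := pselect (exists2 y, lt y x & D y); first exact: IH Dy.
by exists x => // y lyx Dy; apply: nex; exists y.
Qed.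

Lemma wo_asym x y : lt x y -> lt y x -> False.
Proof.
elim/(well_founded_ind lt_wf): y x => y IH x xy yx.
exact: (IH x xy y yx xy).
Qed.

Lemma wo_trans x y z : lt x y -> lt y z -> lt x z.
Proof.
move=> xy yz; case: (lt_tri x z) => // [xz|zx].
  by subst z; case: (wo_asym xy yz).
have [m] := @wo_min [set t | [\/ t = x, t = y | t = z]]
  (ex_intro _ x (Or31 _ _ erefl)).
move=> [->|->|->] H; exfalso.
- by apply: (H _ zx); exact: Or33.
- by apply: (H _ xy); exact: Or31.
- by apply: (H _ yz); exact: Or32.
Qed.

Lemma not_wo_lt x y : ~ lt x y -> y = x \/ lt y x.
Proof. by move=> nxy; case: (lt_tri x y) => // [->|?]; [left|right]. Qed.

Lemma seg_sub x y : lt x y -> seg x `<=` seg y.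
Proof. by move=> xy z zx; exact: wo_trans zx xy. Qed.

(** [Q w] receives the earlier values as a total function. By the first hypothesis only the values
    below [w] count, so the recursion may put [s0] elsewhere. *)
Lemma wf_dep_choice (S : Type) (s0 : S) (Q : W -> (W -> S) -> S -> Prop) :
  (forall w f g x, (forall v, lt v w -> f v = g v) -> Q w f x -> Q w g x) ->
  (forall w f, (forall v, lt v w -> Q v f (f v)) -> exists x, Q w f x) ->
  exists f, forall w, Q w f (f w).
Proof.
move=> ext step.
pose restr w (rec : forall v, lt v w -> S) v :=
  if pselect (lt v w) is left vw then rec v vw else s0.
pose pick (P : S -> Prop) :=
  if pselect (exists x, P x) is left ex then projT1 (cid ex) else s0.
pose F w rec := pick (Q w (@restr w rec)).
pose f := Fix lt_wf (fun=> S) F.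
have fE w : f w = pick (Q w (fun v => if pselect (lt v w) then f v else s0)).
  rewrite /f Fix_eq.
    congr pick; congr (Q w _); apply/funext => v; rewrite /restr.
    by case: pselect.
  move=> x g h gh; rewrite /F; congr pick; congr (Q x _).
  by apply/funext => v; rewrite /restr; case: pselect.
exists f; apply: (well_founded_ind lt_wf) => w IH.
have [x Qx] := step w f IH.
have agree v : lt v w -> f v = (if pselect (lt v w) then f v else s0).
  by case: pselect.
rewrite fE /pick; case: pselect => [h|[]]; last first.
  by exists x; exact: ext Qx.
case: cid => /= y Qy; apply: ext Qy => v vw.
by rewrite -agree.
Qed.

(** Assign to each member of [D] a new element of [Y]. If this is blocked at [v], the values taken
    at members of [D] below [v] exhaust [Y]. *)
Lemma card_le_or_seg (U : Type) (D : set W) (Y : set U) :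
  D #<= Y \/ exists2 v, D v & Y #<= seg v `&` D.
Proof.
have [[w Dw]|D0] := pselect (D !=set0); last first.
  left; suff -> : D = set0 by [].
  by apply/seteqP; split=> // x Dx; case: D0; exists x.
have [[y Yy]|Y0] := pselect (Y !=set0); last first.
  right; exists w => //; suff -> : Y = set0 by [].
  by apply/seteqP; split=> // x Dx; case: Y0; exists x.
have [?|nseg] := pselect (exists2 v, D v & Y #<= seg v `&` D); [by right|left].
pose Q w (f : W -> U) x := D w -> Y x /\ forall v, lt v w -> D v -> f v <> x.
have [||f Qf] := @wf_dep_choice U y Q.
- move=> v f g x fg Qx Dv; have [Yx fx] := Qx Dv; split=> // u uv Du.
  by rewrite -fg //; exact: fx.
- move=> v f IH; apply: contrapT => nex.
  have Dv : D v by apply: contrapT => nDv; apply: nex; exists y.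
  apply: nseg; exists v => //.
  suff Yf : Y `<=` f @` (seg v `&` D).
    exact: card_le_trans (subset_card_le Yf) (card_image_le _ _).
  move=> z Yz; apply: contrapT => nz; apply: nex; exists z => _; split=> //.
  by move=> u uv Du fu; apply: nz; exists u.
- apply: card_le_injP; exists f; split=> [x Dx|x z Dx Dz fxz].
    by case: (Qf x Dx).
  case: (lt_tri x z) => // xz; exfalso.
    by have [_ /(_ x xz Dx)] := Qf z Dz.
  by have [_ /(_ z xz Dz)] := Qf x Dx; rewrite fxz.
Qed.

Definition goedel_max (p : W * W) := if pselect (lt p.1 p.2) then p.2 else p.1.
(** Goedel's order compares maxima first, so that the predecessors of a pair lie in the square of
    the segment up to its maximum. *)
Definition goedel_lt (p q : W * W) := lt (goedel_max p) (goedel_max q) \/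
  (goedel_max p = goedel_max q /\
    (lt p.1 q.1 \/ (p.1 = q.1 /\ lt p.2 q.2))).

Lemma goedel_wo : strict_wo goedel_lt.
Proof.
split.
  suff H m a b p : goedel_max p = m -> p.1 = a -> p.2 = b -> Acc goedel_lt p.
    by move=> p; exact: H.
  elim/(well_founded_ind lt_wf): m a b p => m IHm.
  elim/(well_founded_ind lt_wf) => a IHa.
  elim/(well_founded_ind lt_wf) => b IHb p pm pa pb.
  constructor=> q [|[qm [|[qa]]]].
  - by rewrite pm => /IHm; apply.
  - by rewrite pa => /IHa; apply; rewrite // qm.
  - by rewrite pb => /IHb; apply; rewrite ?qm ?qa.
move=> p q; case: (lt_tri (goedel_max p) (goedel_max q)) => m.
- by apply: Or31; left.
- case: (lt_tri p.1 q.1) => a.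
  + by apply: Or31; right; split=> //; left.
  + case: (lt_tri p.2 q.2) => b.
    * by apply: Or31; right; split=> //; right.
    * by apply: Or32; rewrite (surjective_pairing p) a b -surjective_pairing.
    * by apply: Or33; right; split=> //; right.
  + by apply: Or33; right; split=> //; left.
- by apply: Or33; left.
Qed.

End StrictWellOrder.

Section Hessenberg.
Context (W : Type) (lt : W -> W -> Prop) (ltwo : strict_wo lt).

(** Induction on [u]; an earlier segment of the same size settles the claim. Otherwise a failure
    would embed [seg lt u] into the predecessors of some [(c, d)], hence into the square of the
    segment up to their maximum [m]. That square is finite or, by induction, no larger than
    [seg lt m]. *)
Lemma hessenberg u : infinite_set (seg lt u) ->
  seg lt u `*` seg lt u #<= seg lt u.
Proof.
elim/(well_founded_ind ltwo.1): u => u IH infu.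
have [[v vu uv]|min] := pselect (exists2 v, lt v u & seg lt u #<= seg lt v).
  have infv : infinite_set (seg lt v).
    by move=> /(card_le_finite uv).
  apply: card_le_trans (card_leX uv uv) _.
  apply: card_le_trans (IH v vu infv) _.
  by apply: subset_card_le; exact: (seg_sub ltwo vu).
have [//|[[c d] [/= cu du] small]] := card_le_or_seg (goedel_wo ltwo)
  (seg lt u `*` seg lt u) (seg lt u).
pose m := goedel_max lt (c, d).
have mu : lt m u by rewrite /m /goedel_max /=; case: pselect.
pose S := seg lt m `|` [set m].
have sub : seg (goedel_lt lt) (c, d) `&` (seg lt u `*` seg lt u) `<=` S `*` S.
  move=> [x y] [+ _].
  have maxl p : p.1 = goedel_max lt p \/ lt p.1 (goedel_max lt p).
    by rewrite /goedel_max; case: pselect => xy; [right|left].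
  have maxr p : p.2 = goedel_max lt p \/ lt p.2 (goedel_max lt p).
    rewrite /goedel_max; case: pselect => xy; first by left.
    by case: (not_wo_lt ltwo xy); [left|right].
  have mS z : z = m \/ lt z m -> S z by case=> [->|]; [right|left].
  have : forall z, z = goedel_max lt (x, y) \/ lt z (goedel_max lt (x, y)) ->
      goedel_lt lt (x, y) (c, d) -> S z.
    move=> z zxy [xym|[xym _]]; apply: mS; rewrite -/m in xym.
      by case: zxy => [->|zm]; right=> //; exact: wo_trans zm xym.
    by rewrite -xym.
  by move=> H xycd; split; apply: H xycd; [exact: maxl|exact: maxr].
have leS := card_le_trans small (subset_card_le sub).
exfalso; have [finm|infm] := pselect (finite_set (seg lt m)).
  apply: infu; apply: card_le_finite leS _; by apply: finite_setX;
    rewrite finite_setU; split.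
have Sm : S #<= seg lt m by apply: infinite_setU_countable => //;
  exact: countable1.
apply: min; exists m => //; apply: card_le_trans leS _.
exact: card_le_trans (card_leX Sm Sm) (IH m mu infm).
Qed.

End Hessenberg.

(** * Almost inclusion and properties holding almost everywhere on a set *)

Definition eventually_in (A : set nat) (P : nat -> Prop) : Prop :=
  exists N, forall n, N <= n -> A n -> P n.

Definition unbounded_nat (A : set nat) : Prop :=
  forall N, exists2 n, N <= n & A n.

Section Eventually.
Implicit Types (A B : set nat) (P Q R : nat -> Prop).

Lemma evT A P : (forall n, A n -> P n) -> eventually_in A P.
Proof. by move=> AP; exists 0 => n _; exact: AP. Qed.

Lemma ev_mono A P Q : (forall n, A n -> P n -> Q n) ->
  eventually_in A P -> eventually_in A Q.
Proof. by move=> PQ [N H]; exists N => n Nn An; apply: PQ => //; exact: H. Qed.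

Lemma ev_and A P Q : eventually_in A P -> eventually_in A Q ->
  eventually_in A (fun n => P n /\ Q n).
Proof.
move=> [N H] [M H']; exists (maxn N M) => n; rewrite geq_max => /andP[Nn Mn] An.
by split; [exact: H|exact: H'].
Qed.

Lemma ev_mono2 A P Q R : (forall n, A n -> P n -> Q n -> R n) ->
  eventually_in A P -> eventually_in A Q -> eventually_in A R.
Proof.
move=> PQR P_ Q_; apply: ev_mono (ev_and P_ Q_) => n An [Pn Qn].
exact: PQR.
Qed.

Lemma ev_sub A B P : eventually_in B A -> eventually_in A P -> eventually_in B
  P.
Proof.
move=> [N BA] [M AP]; exists (maxn N M) => n.
by rewrite geq_max => /andP[Nn Mn] Bn; apply: AP => //; exact: BA.
Qed.

Lemma ev_refl A : eventually_in A A.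
Proof. exact: evT. Qed.

Lemma ev_seq A (J : eqType) (s : seq J) (P : J -> nat -> Prop) :
  (forall j, j \in s -> eventually_in A (P j)) ->
  eventually_in A (fun n => forall j, j \in s -> P j n).
Proof.
elim: s => [_|i s IH H]; first exact: evT.
have Pi : eventually_in A (P i) by apply: H; rewrite mem_head.
have {}IH : eventually_in A (fun n => forall j, j \in s -> P j n).
  by apply: IH => j js; apply: H; rewrite inE js orbT.
apply: ev_mono2 Pi IH => n _ Pin Psn j.
by rewrite inE => /orP[/eqP->|/Psn].
Qed.

Lemma ev_unbounded A P N : unbounded_nat A -> eventually_in A P ->
  exists n, [/\ N <= n, A n & P n].
Proof.
move=> Ainf [M H]; have [n] := Ainf (maxn N M).
by rewrite geq_max => /andP[Nn Mn] An; exists n; split=> //; exact: H.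
Qed.

Lemma sub_unbounded A B : unbounded_nat A -> eventually_in A B ->
  unbounded_nat B.
Proof.
move=> Ainf AB N; have [n [Nn _ Bn]] := ev_unbounded N Ainf AB.
by exists n.
Qed.

End Eventually.

Lemma exists_bound (f : nat -> nat) N : exists M, forall n, n < N -> f n < M.
Proof.
elim: N => [|N [M HM]]; first by exists 0.
exists (maxn M (f N).+1) => n; rewrite ltnS leq_max => nN.
case: (ltngtP n N) nN => // [/HM ->//|->]; by rewrite ltnSn orbT.
Qed.

Lemma finite_set_nat_bounded (A : set nat) :
  finite_set A <-> exists N, forall n, A n -> n < N.
Proof.
split=> [/finite_seqP[s ->]|[N AN]].
  elim: s => [|m s [N IH]]; first by exists 0.
  exists (maxn m.+1 N) => n /=; rewrite inE leq_max => /orP[/eqP->|/IH->].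
    by rewrite ltnSn.
  by rewrite orbT.
by apply: sub_finite_set (finite_II N) => n /AN.
Qed.

Lemma almost_subsetP (A B : set nat) : almost_subset A B <-> eventually_in A B.
Proof.
rewrite /almost_subset finite_set_nat_bounded; split=> -[N H]; exists N => n.
  move=> Nn An; apply: contrapT => nB.
  by have := H n (conj An nB); rewrite ltnNge Nn.
by case=> An nBn; rewrite ltnNge; apply/negP => Nn; apply: nBn; exact: H.
Qed.

Lemma infinite_set_natP (A : set nat) : infinite_set A <-> unbounded_nat A.
Proof.
rewrite finite_set_nat_bounded; split=> [nA N|Ainf [N H]].
  apply: contrapT => nex; apply: nA; exists N => n An.
  by rewrite ltnNge; apply/negP => Nn; apply: nex; exists n.
by have [n Nn /H] := Ainf N; rewrite ltnNge Nn.
Qed.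

Lemma mem_leq_sumn (s : seq nat) x : x \in s -> x <= sumn s.
Proof.
elim: s => // y s IH; rewrite inE => /orP[/eqP->|/IH h] /=;
  first exact: leq_addr.
exact: leq_trans h (leq_addl _ _).
Qed.

Lemma lower_bound_strong_fip (H : set (set nat)) : (forall F, finite_set F ->
  F `<=` H -> exists2 A, infinite_set A & lower_bound_of F A) -> strong_fip H.
Proof.
move=> lbH F finF FH; have [A /infinite_set_natP Ainf Alb] := lbH F finF FH.
apply/infinite_set_natP; apply: (sub_unbounded Ainf).
have [s Fs] := (finite_seqP F).1 finF.
have : eventually_in A (fun n => forall B, B \in s -> B n).
  by apply: ev_seq => B Bs; apply/almost_subsetP; apply: Alb; rewrite Fs.
by apply: ev_mono => n _ sn B FB; apply: sn; rewrite Fs in FB.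
Qed.

Lemma chain_centered (S H : set (set nat)) : S !=set0 -> almost_chain S H ->
  centered S H.
Proof.
move=> [A0 SA0] [HS Hch]; split=> // F /finite_seqP[s ->].
have [->|/eqP s0] := eqVneq s [::]; first by exists A0.
suff : s <> [::] -> [set` s] `<=` H -> exists2 A,
  H A & lower_bound_of [set` s] A.
  by move=> /(_ s0) lb /lb[A /HS ? ?]; exists A.
elim: s {s0} => // B s IH _ sH.
have HB : H B by apply: sH; rewrite /= mem_head.
have sH' : [set` s] `<=` H by move=> C Cs; apply: sH;
  rewrite /= inE (Cs : C \in s) orbT.
have lb A : H A -> almost_subset A B -> lower_bound_of [set` s] A ->
    exists2 A, H A & lower_bound_of [set` B :: s] A.
  move=> HA AB As; exists A => // C /=; rewrite inE => /orP[/eqP->//|].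
  exact: As.
have BB : almost_subset B B by apply/almost_subsetP; exact: ev_refl.
have [s0|/eqP s0] := eqVneq s [::]; first by apply: lb BB _ => //; rewrite s0.
have [A HA As] := IH s0 sH'.
have [AB|BA] := Hch A B HA HB; first exact: lb HA AB As.
apply: lb BB _ => // C Cs; apply/almost_subsetP.
apply: (ev_sub ((almost_subsetP _ _).1 BA)); apply/almost_subsetP.
exact: As.
Qed.

Lemma wo_max (W : eqType) (lt : W -> W -> Prop) (ltwo : strict_wo lt)
  (s : seq W) : s <> [::] ->
  exists2 m, m \in s & forall x, x \in s -> x = m \/ lt x m.
Proof.
elim: s => // x [_|y s /(_ _)[//|m ms mmax]] _.
  by exists x; [rewrite mem_head|move=> y; rewrite inE => /eqP ->; left].
case: (ltwo.2 x m) => [xm|xm|mx].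
- exists m; first by rewrite inE ms orbT.
  by move=> z; rewrite inE => /orP[/eqP ->|/mmax //]; right.
- exists m; first by rewrite inE ms orbT.
  by move=> z; rewrite inE => /orP[/eqP ->|/mmax //]; left.
- exists x; first by rewrite mem_head.
  move=> z; rewrite inE => /orP[/eqP ->|/mmax[->|zm]]; [by left|by right|right].
  exact: (wo_trans ltwo zm mx).
Qed.

Section TowerChain.
Context (W : Type) (lt : W -> W -> Prop) (ltwo : strict_wo lt).
Context (D : set W) (X : W -> set nat).
Hypothesis Xdec :
  forall v w, D v -> D w -> lt v w -> eventually_in (X w) (X v).

Lemma tower_chain (S : set (set nat)) : (forall w, D w -> S (X w)) ->
  almost_chain S (X @` D).
Proof.
move=> SX; split=> [_ [w Dw <-]|_ _ [v Dv <-] [w Dw <-]]; first exact: SX.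
rewrite !almost_subsetP; case: (ltwo.2 v w) => [vw|->|wv].
- by right; exact: Xdec.
- by left; exact: ev_refl.
- by left; exact: Xdec.
Qed.

Lemma tower_strong_fip : (forall w, D w -> unbounded_nat (X w)) ->
  strong_fip (X @` D).
Proof.
move=> Xinf; apply: lower_bound_strong_fip.
have ch : almost_chain (fun A => infinite_set A) (X @` D).
  by apply: tower_chain => w Dw; apply/infinite_set_natP; exact: Xinf.
by apply: (chain_centered _ ch).2; exists setT; exact: infinite_nat.
Qed.

End TowerChain.

(** * Small sets and saturation below p *)

Definition small (W : Type) (J : Type) (D : set J) : Prop :=
  ~ ([set: W] #<= D).

(* The order type of [W] is an uncountable cardinal which is at most p. *)
Record p_order (W : choiceType) (lt : W -> W -> Prop) : Prop := {
  p_order_wo : strict_wo lt;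
  p_order_uncountable : ~ countable [set: W];
  p_order_seg : forall w, small W (seg lt w);
  p_order_pseudo_intersection : forall H : set (set nat), small W H ->
    strong_fip H -> exists2 A, infinite_set A & lower_bound_of H A }.

Section Saturation.
Context (W : choiceType) (lt : W -> W -> Prop) (Wp : p_order lt).
Let ltwo : strict_wo lt := p_order_wo Wp.
Let small := @small W.

Lemma small_le (J K : Type) (D : set J) (E : set K) :
  D #<= E -> small E -> small D.
Proof. by move=> DE sE WD; apply: sE; exact: card_le_trans DE. Qed.

Lemma small_setU (J : Type) (D C : set J) :
  small D -> countable C -> small (D `|` C).
Proof.
move=> sD cC; have [finD|infD] := pselect (finite_set D).
  move=> WDC; apply: (p_order_uncountable Wp); apply: sub_countable WDC _.
  have cD := finite_set_countable finD.
  suff -> : D `|` C = \bigcup_(b in [set: bool]) (if b then D else C).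
    by apply: bigcup_countable => // -[].
  apply/seteqP; split=> [x [Dx|Cx]|x [[] _ ?]];
    [by exists true|by exists false|by left|by right].
exact: small_le (infinite_setU_countable infD cC) sD.
Qed.

Lemma W_inhabited : exists w : W, True.
Proof.
apply: contrapT => nW; apply: (p_order_uncountable Wp).
suff -> : [set: W] = set0 by exact: countable0.
by apply/seteqP; split=> // w _; apply: nW; exists w.
Qed.

Lemma W_nomax w : exists v, lt w v.
Proof.
apply: contrapT => nv.
have WE : [set: W] = seg lt w `|` [set w].
  apply/seteqP; split=> // x _; case: (ltwo.2 x w) => [?|->|wx];
    [by left|by right|].
  by case: nv; exists x.
by have := small_setU (@p_order_seg _ _ Wp w) (countable1 w); rewrite -WE;
  apply.
Qed.

(* Pass to the set of all codes of pairs [(n, t)] and take a pseudo-intersection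
   of the graphs of the [X j] which also meets each column in a finite set. *)
Lemma saturation (J : choiceType) (D : set J) (T : countType)
    (X : J -> nat -> T -> Prop) (A : set nat) : small D -> unbounded_nat A ->
  (forall s : seq J, (forall j, j \in s -> D j) ->
    eventually_in A (fun n => exists t, forall j, j \in s -> X j n t)) ->
  exists B (f : nat -> T), [/\ unbounded_nat B, eventually_in B A &
    forall j, D j -> eventually_in B (fun n => X j n (f n))].
Proof.
move=> sD Ainf fip.
have [n0 [_ _ [t0 _]]] := ev_unbounded 0 Ainf (fip [::] (fun j => ltac:(done))).
pose c (n : nat) (t : T) : nat := pickle (n, t).
pose p z : nat := if @unpickle (nat * T)%type z is Some nt then nt.1 else 0.
have pc n t : p (c n t) = n by rewrite /p /c (@pickleK (nat * T)%type).
have cinj n t n' t' : c n t = c n' t' -> (n, t) = (n', t').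
  by move=> /(congr1 (@unpickle (nat * T)%type)); rewrite !pickleK => -[-> ->].
pose graph j : set nat := [set z | exists n t, [/\ z = c n t, A n & X j n t]].
pose col m : set nat := [set z | exists n t, [/\ z = c n t, A n & m <= n]].
pose H := [set graph j | j in D] `|` [set col m | m in [set: nat]].
have sH : small H.
  refine (small_setU (small_le (card_image_le _ _) sD) _).
  by apply: (sub_countable (card_image_le _ _)); exact: countableP.
have fipH : strong_fip H.
  move=> F /finite_seqP[fs ->] FH.
  have [s [M [sD' HF]]] : exists (s : seq J) (M : nat), (forall j,
    j \in s -> D j) /\
      forall n t, A n -> M <= n -> (forall j, j \in s -> X j n t) ->
      forall B, B \in fs -> B (c n t).
    elim: fs FH => [_|B fs IH FH]; first by exists [::], 0; split.
    have [|s [M [sD' HF]]] := IH.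
      by move=> C Cfs; apply: FH; rewrite /= inE Cfs orbT.
    have : H B by apply: FH; rewrite /= mem_head.
    case=> [[j Dj <-]|[m _ <-]].
      exists (j :: s), M; split=> [i|n t An Mn Xt C].
        by rewrite inE => /orP[/eqP->|/sD'].
      rewrite inE => /orP[/eqP->|].
        by exists n, t; split=> //; apply: Xt; rewrite mem_head.
      by apply: HF => // i si; apply: Xt; rewrite inE si orbT.
    exists s, (maxn m M); split=> [//|n t An + Xt C].
    rewrite geq_max => /andP[mn Mn]; rewrite inE => /orP[/eqP->|].
      by exists n, t.
    exact: HF.
  move=> finI; have /finite_set_nat_bounded[N HN] := finite_image p finI.
  have [n [+ An [t Xt]]] := ev_unbounded (maxn M N) Ainf (fip s sD').
  rewrite geq_max => /andP[Mn Nn].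
  have : n < N by apply: HN; exists (c n t) => //= B; exact: HF.
  by rewrite ltnNge Nn.
have [Z /infinite_set_natP Zinf Zlb] := p_order_pseudo_intersection Wp sH fipH.
pose B : set nat := [set n | A n /\ exists t, Z (c n t)].
pose f n := if pselect (exists t,
  Z (c n t)) is left e then projT1 (cid e) else t0.
have fP n : B n -> Z (c n (f n)).
  by rewrite /f; case: pselect => [e _|ne [_ /ne]//]; case: cid.
have Bev C : eventually_in Z C -> eventually_in B (fun n => C (c n (f n))).
  move=> [N HN]; have [M HM] := exists_bound p N.
  exists M => n Mn Bn; apply: HN; last exact: fP.
  rewrite leqNgt; apply/negP => /HM; rewrite pc.
  by rewrite ltnNge Mn.
exists B, f; split.
- move=> N; have HcolN : H (col N) by right; exists N.
  have [z [_ Zz [n [t [zE An Nn]]]]] :=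
    ev_unbounded 0 Zinf ((almost_subsetP _ _).1 (Zlb _ HcolN)).
  by exists n => //; split=> //; exists t; rewrite -zE.
- by apply: evT => n [].
- move=> j Dj; have Hj : H (graph j) by left; exists j.
  apply: ev_mono (Bev _ ((almost_subsetP _ _).1 (Zlb _ Hj))) => n Bn.
  by case=> n' [t [/cinj[-> ->]]].
Qed.

End Saturation.

(** * Constructions of length p if all towers are bounded (to be refuted) *)

Definition towers_bounded (W : Type) (lt : W -> W -> Prop) : Prop :=
  forall X : W -> set nat, (forall w, unbounded_nat (X w)) ->
    (forall v w, lt v w -> eventually_in (X w) (X v)) ->
    exists2 B, unbounded_nat B & forall w, eventually_in B (X w).

Section BoundedTowers.
Context (W : choiceType) (lt : W -> W -> Prop) (Wp : p_order lt).
Context (towB : towers_bounded lt).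
Let ltwo : strict_wo lt := p_order_wo Wp.

Lemma seg_tower_bounded w (X : W -> set nat) :
  (forall v, lt v w -> unbounded_nat (X v)) ->
  (forall u v, lt v w -> lt u v -> eventually_in (X v) (X u)) ->
  exists2 B, unbounded_nat B & forall v, lt v w -> eventually_in B (X v).
Proof.
move=> Xinf Xdec.
have sm : small W (X @` seg lt w).
  exact: small_le (card_image_le _ _) (@p_order_seg _ _ Wp w).
have [|B /infinite_set_natP Binf Blb] := p_order_pseudo_intersection Wp sm.
  by apply: (tower_strong_fip ltwo) => [u v _ vw uv|v vw];
    [exact: Xdec|exact: Xinf].
exists B => // v vw; apply/almost_subsetP; apply: Blb.
by exists v.
Qed.

(* A descending transfinite construction of length p: at each stage the current
   set may be shrunk in order to choose the next value of [f]. *)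
Lemma shrinking_choice (S : Type) (s0 : S)
    (Q : W -> set nat -> (W -> S) -> S -> Prop) (A : set nat) :
  (forall w B f g x, (forall v, lt v w -> f v = g v) -> Q w B f x ->
    Q w B g x) ->
  (forall w B C f x, eventually_in C B -> Q w B f x -> Q w C f x) ->
  (forall w B f, unbounded_nat B -> eventually_in B A ->
    (forall v, lt v w -> Q v B f (f v)) ->
    exists C x, [/\ unbounded_nat C, eventually_in C B & Q w C f x]) ->
  unbounded_nat A ->
  exists B f, [/\ unbounded_nat B, eventually_in B A &
    forall w, Q w B f (f w)].
Proof.
move=> ext mono step Ainf.
(* The recursion chooses a set together with a value. The sets form a tower, which is bounded below
   each [w] since segments are small, and in the end by [towB]. *)
pose Q' w (F : W -> set nat * S) (x : set nat * S) :=
  [/\ unbounded_nat x.1, eventually_in x.1 A,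
    forall v, lt v w -> eventually_in x.1 (F v).1 & Q w x.1 (snd \o F) x.2].
have [||F QF] := @wf_dep_choice W lt ltwo _ (set0, s0) Q'.
- move=> w F G x FG [? ? Fx Qx]; split=> //.
    by move=> v vw; rewrite -FG //; exact: Fx.
  by apply: ext Qx => v vw /=; rewrite FG.
- move=> w F IH.
  have [C [Cinf CA CF]] : exists C, [/\ unbounded_nat C, eventually_in C A &
      forall v, lt v w -> eventually_in C (F v).1].
    have [[v0 v0w]|nv] := pselect (exists v, lt v w); last first.
      exists A; split=> // [|v vw]; first exact: ev_refl.
      by case: nv; exists v.
    have [||C Cinf CF] := @seg_tower_bounded w (fst \o F).
    + by move=> v vw; have [] := IH v vw.
    + by move=> u v vw uv; have [_ _ /(_ u uv)] := IH v vw.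
    exists C; split=> //; apply: ev_sub (CF _ v0w) _.
    by have [] := IH v0 v0w.
  have [|D [x [Dinf DC Qx]]] := step w C (snd \o F) Cinf CA.
    by move=> v vw; apply: mono (CF v vw) _; have [] := IH v vw.
  exists (D, x); split=> //=; first exact: ev_sub DC CA.
  by move=> v vw; exact: ev_sub DC (CF v vw).
have [||B Binf BF] := towB (X := fst \o F).
- by move=> w; have [] := QF w.
- by move=> v w vw; have [_ _ /(_ v vw)] := QF w.
exists B, (snd \o F); split=> //.
  have [w _] := W_inhabited Wp; apply: ev_sub (BF w) _.
  by have [] := QF w.
by move=> w; apply: mono (BF w) _; have [] := QF w.
Qed.

Lemma exists_sparse_subset (h : nat -> nat) (A : set nat) : unbounded_nat A ->
  exists B, [/\ unbounded_nat B, B `<=` A &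
    forall a b, B a -> B b -> a < b -> h a < b].
Proof.
move=> Ainf; have /choice[nx nxP] : forall N, exists n, N <= n /\ A n.
  by move=> N; have [n ? ?] := Ainf N; exists n.
pose x := fix x k := if k is k'.+1 then nx (maxn (h (x k')) (x k')).+1 else nx
  0.
have xA k : A (x k) by case: k => [|k]; exact: (nxP _).2.
have xS k : h (x k) < x k.+1 /\ x k < x k.+1.
  have := (nxP (maxn (h (x k)) (x k)).+1).1.
  by rewrite gtn_max => /andP[].
have xmono : {homo x : i j / i < j}.
  by apply: homo_ltn => [|i]; [exact: ltn_trans|exact: (xS i).2].
have xle i j : i <= j -> x i <= x j.
  by rewrite leq_eqVlt => /orP[/eqP->//|/xmono/ltnW].
exists (range x); split.
- move=> N; exists (x N); last by exists N.
  by elim: N => // N IH; apply: leq_ltn_trans IH _; exact: (xS N).2.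
- by move=> _ [k _ <-].
- move=> _ _ [i _ <-] [j _ <-] xij.
  have ij : i < j by rewrite ltnNge; apply/negP => /xle; rewrite leqNgt xij.
  exact: leq_trans (xS i).1 (xle _ _ ij).
Qed.

(* A set which is almost contained in [h w]-sparse sets for all [w]: its
   next-but-one element function dominates every [h w]. *)
Lemma dominating (h : W -> nat -> nat) : exists g : nat -> nat,
  forall w, eventually_in setT (fun n => h w n <= g n).
Proof.
(* A monotone majorant: its bound at [nx n], a member of [A], also serves for [n], which need not be
   in [A]. *)
pose h' w n := \max_(i < n.+1) h w i.
have h'P w n m : n <= m -> h w n <= h' w m.
  by move=> nm; rewrite (@leq_bigmax _ (fun i : 'I_m.+1 =>
    h w i) (Ordinal (nm : n < m.+1))).
pose Q w (A : set nat) (f : W -> unit) (x : unit) :=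
  exists N, forall a b, A a -> A b -> N <= a -> a < b -> h' w a < b.
have [||||A [? [Ainf _ QA]]] := @shrinking_choice unit tt Q setT.
- by [].
- move=> w B C f x [N CB] [M HM]; exists (maxn N M) => a b Ca Cb.
  rewrite geq_max => /andP[Na Ma] ab; apply: HM => //; apply: CB => //.
  exact: leq_trans Na (ltnW ab).
- move=> w B f Binf _ _; have [C [Cinf CB Csp]] := exists_sparse_subset (h' w)
    Binf.
  exists C, tt; split=> //; first by apply: evT => n /CB.
  by exists 0 => a b Ca Cb _; exact: Csp.
- by move=> N; exists N.
have /choice[nx nxP] : forall N, exists n, N < n /\ A n.
  by move=> N; have [n ? ?] := Ainf N.+1; exists n.
exists (nx \o nx) => w; have [N HN] := QA w; exists N => n Nn _ /=.
have [n1 An1] := nxP n; have [n2 An2] := nxP (nx n).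
apply: leq_trans (h'P w n (nx n) (ltnW n1)) _; apply: ltnW; apply: HN => //.
exact: leq_trans Nn (ltnW n1).
Qed.

Lemma increasing_functions : exists b : W -> nat -> nat,
  forall v w, lt v w -> eventually_in setT (fun n => b v n < b w n).
Proof.
pose Q w (f : W -> nat -> nat) (x : nat -> nat) :=
  forall v, lt v w -> eventually_in setT (fun n => f v n < x n).
have [||b Qb] := @wf_dep_choice W lt ltwo _ (fun=> 0) Q.
- by move=> w f g x fg Qx v vw; rewrite -fg //; exact: Qx.
- move=> w f _; have [g Hg] := dominating (fun v n => (f v n).+1).
  by exists g => v _; exact: Hg.
by exists b => v w vw; exact: Qb vw.
Qed.

Section Paths.
Context (T : countType) (R : T -> T -> Prop).
Hypothesis Rrefl : forall x, R x x.

(** Saturation leaves finitely many [s v] to be bounded at a time, and the one with the largest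
    index bounds the others. *)
Lemma seg_path_bounded w (t0 : T) (s : W -> nat -> T) (A : set nat) :
  unbounded_nat A ->
  (forall u v, lt v w -> lt u v ->
    eventually_in A (fun n => R (s u n) (s v n))) ->
  exists B t, [/\ unbounded_nat B, eventually_in B A &
    forall v, lt v w -> eventually_in B (fun n => R (s v n) (t n))].
Proof.
move=> Ainf sinc.
apply: (@saturation _ _ Wp W (seg lt w) T (fun v n t => R (s v n) t)) => //.
  exact: p_order_seg Wp _.
move=> q qw; have [->|/eqP q0] := eqVneq q [::].
  by apply: evT => n _; exists t0.
have [m mq mmax] := wo_max ltwo q0.
suff : eventually_in A (fun n => forall j, j \in q -> R (s j n) (s m n)).
  by apply: ev_mono => n An H; exists (s m n).
apply: ev_seq => v /mmax[->|vm]; first exact: evT.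
by apply: sinc => //; exact: qw.
Qed.

(* Bounding the codes of the [s w n] makes the sets of all [(n, t)] with [t]
   above [s w n] decrease modulo finite sets. *)
Lemma path_bounded (Rtrans : forall x y z, R x y -> R y z -> R x z)
    (s : W -> nat -> T) (A : set nat) : unbounded_nat A ->
  (forall v w, lt v w -> eventually_in A (fun n => R (s v n) (s w n))) ->
  exists B t, [/\ unbounded_nat B, eventually_in B A &
    forall w, eventually_in B (fun n => R (s w n) (t n))].
Proof.
move=> Ainf sinc.
have [w0 _] := W_inhabited Wp; pose t0 := s w0 0.
have [g Hg] := dominating (fun w n => pickle (s w n)).
pose c (n : nat) (t : T) : nat := pickle (n, t).
have cinj n t n' t' : c n t = c n' t' -> (n, t) = (n', t').
  by move=> /(congr1 (@unpickle (nat * T)%type)); rewrite !pickleK => -[-> ->].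
pose p z : nat := if @unpickle (nat * T)%type z is Some nt then nt.1 else 0.
have pc n t : p (c n t) = n by rewrite /p /c (@pickleK (nat * T)%type).
pose X w : set nat := [set z | exists n t,
  [/\ z = c n t, A n, pickle t <= g n & R (s w n) t]].
(* The bound [g] leaves finitely many codes over each [n], so far out in [X w] the first components
   are large. This turns relations valid from some [n] on into almost inclusions. *)
have cbound N : exists M, forall n t, n < N -> pickle t <= g n -> c n t < M.
  pose e n k := if unpickle k is Some t then c n t else 0.
  have /choice[m mP] : forall n, exists m, forall k, k < (g n).+1 -> e n k < m.
    by move=> n; exact: exists_bound.
  have [M HM] := exists_bound m N; exists M => n t nN tg.
  apply: ltn_trans (HM n nN); have := mP n (pickle t) tg.
  by rewrite /e pickleK.
have Xpr w N : exists M, forall n t, X w (c n t) -> M <= c n t -> N <= n.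
  have [M HM] := cbound N; exists M => n t [n' [t' [/cinj[<- <-] _ tg _]]] Mc.
  by rewrite leqNgt; apply/negP => /HM /(_ tg); rewrite ltnNge Mc.
have Xinf w : unbounded_nat (X w).
  move=> M; have [N HN] := exists_bound p M.
  have [n [Nn An gn]] :=
    ev_unbounded N Ainf (ev_sub (evT (fun n _ => I)) (Hg w)).
  exists (c n (s w n)); last by exists n, (s w n).
  by rewrite leqNgt; apply/negP => /HN; rewrite pc ltnNge Nn.
have [//||Z Zinf ZX] := towB (X := X).
  move=> v w vw; have [N HN] := sinc v w vw; have [M HM] := Xpr w N.
  exists M => z Mz Xz; have [n [t [zE An tg Rt]]] := Xz; subst z.
  exists n, t; split=> //; apply: Rtrans Rt; apply: HN => //.
  exact: HM Mz.
pose B : set nat := [set n | A n /\ exists t, Z (c n t)].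
pose f n := if pselect (exists t,
  Z (c n t)) is left e then projT1 (cid e) else t0.
have fP n : B n -> Z (c n (f n)).
  by rewrite /f; case: pselect => [e _|ne [_ /ne]//]; case: cid.
exists B, f; split.
- move=> N; have [M HM] := Xpr w0 N.
  have [z [Mz Zz Xz]] := ev_unbounded M Zinf (ZX w0).
  have [n [t [zE An _ _]]] := Xz; subst z; exists n; first exact: HM Xz Mz.
  by split=> //; exists t.
- by apply: evT => n [].
- move=> w; have [N HN] := ZX w; have [M HM] := exists_bound p N.
  exists M => n Mn Bn; have [||n' [t' [/cinj[-> ->]]]//] := HN (c n (f n)).
    by rewrite leqNgt; apply/negP => /HM; rewrite pc ltnNge Mn.
  exact: fP.
Qed.

End Paths.

End BoundedTowers.

(** * Filling gaps above an increasing sequence of functions *)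

Lemma exists_last (P : nat -> Prop) N : P 0 ->
  exists m, [/\ m <= N, P m & forall k, k <= N -> P k -> k <= m].
Proof.
move=> P0; elim: N => [|N [m [mN Pm mmax]]].
  by exists 0; split=> // k; rewrite leqn0 => /eqP->.
have [PN|nPN] := pselect (P N.+1); first by exists N.+1.
exists m; split=> // [|k]; first exact: leqW.
by rewrite leq_eqVlt => /orP[/eqP->//|kN]; exact: mmax.
Qed.

Section Gaps.
Context (W : choiceType) (lt : W -> W -> Prop) (Wp : p_order lt).
Context (towB : towers_bounded lt).
Let ltwo : strict_wo lt := p_order_wo Wp.
Context (b : W -> nat -> nat).
Hypothesis b_incr :
  forall v w, lt v w -> eventually_in setT (fun n => b v n < b w n).

Lemma b_lt A v w : lt v w -> eventually_in A (fun n => b v n < b w n).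
Proof. by move=> /b_incr; apply: ev_sub; exact: evT. Qed.

Lemma b_le A v w : v = w \/ lt v w -> eventually_in A (fun n => b v n <= b w n).
Proof.
by case=> [->|/(b_lt A)]; [exact: evT|apply: ev_mono => n _; exact: ltnW].
Qed.

(* The sequence [s n] is built by transfinite recursion on its length [b w n];
   at stage [w], saturation provides both the length [e] up to which an upper
   bound of the earlier sequences is still correct and a value [x] with which
   it can be continued. *)
Lemma internal_sequence (T : countType) (t0 : T)
    (G : W -> nat -> nat -> T -> Prop) (A : set nat) :
  unbounded_nat A ->
  (forall v n e e' x, e <= e' -> G v n e' x -> G v n e x) ->
  (forall (q : seq W) w,
    eventually_in A (fun n => exists x, forall v,
      v \in q -> G v n (b w n) x)) ->
  exists B (s : nat -> seq T), [/\ unbounded_nat B, eventually_in B A &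
    forall v w, eventually_in B (fun n =>
      forall e, b v n <= e -> e < b w n -> G v n e (nth t0 (s n) e))].
Proof.
move=> Ainf Ganti Gfip.
pose ok v n l (x : seq T) :=
  forall e, b v n <= e -> e < l -> e < size x -> G v n e (nth t0 x e).
have ok_prefix v n l x y : prefix x y -> l <= size x -> ok v n l x -> ok v n l
  y.
  move=> /prefixP[z ->] lx okx e be el _.
  by rewrite nth_cat (leq_trans el lx); apply: okx => //; exact: leq_trans lx.
pose Q w (B : set nat) (f : W -> nat -> seq T) (x : nat -> seq T) :=
  [/\ eventually_in B (fun n => size (x n) = b w n),
    forall v, lt v w -> eventually_in B (fun n => prefix (f v n) (x n)) &
    forall v, lt v w -> eventually_in B (fun n => ok v n (b w n) (x n))].
have [|||B [f [Binf BA fQ]]] :=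
  @shrinking_choice _ _ Wp towB _ (fun=> [::]) Q A _ _ _ Ainf.
- move=> w B f g x fg [Qs Qp Qo]; split=> // v vw.
  by rewrite -fg //; exact: Qp.
- move=> w B C f x CB [Qs Qp Qo].
  by split=> [|v vw|v vw]; [exact: ev_sub CB Qs|exact: ev_sub CB (Qp v vw)
                           |exact: ev_sub CB (Qo v vw)].
- move=> w B f Binf BA IH.
  have [|B1 [s [B1inf B1B sP]]] := @seg_path_bounded _ _ Wp _
      (fun x y : seq T => prefix x y) (@prefix_refl T) w [::] f B Binf.
    by move=> u v vw uv; have [_ /(_ u uv)] := IH v vw.
  pose X v n (p : nat * T) :=
    [/\ b v n <= p.1, G v n (b w n) p.2 & ok v n p.1 (s n)].
  have [|C [ex [Cinf CB1 CX]]] :=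
    @saturation _ _ Wp W (seg lt w) (nat * T)%type X B1
      (@p_order_seg _ _ Wp w) B1inf.
    move=> q qw.
    have Gq := ev_sub (ev_sub B1B BA) (Gfip q w).
    have [q0|/eqP q0] := eqVneq q [::].
      by apply: ev_mono Gq => n _ [x _]; exists (0, x) => j; rewrite q0.
    have [m mq mmax] := wo_max ltwo q0; have mw := qw m mq.
    have [Qs _ Qo] := IH m mw.
    (* For the largest [m] in [q] the cut at length [b m n] works: [s n] extends [f m n], which has
       this length and is correct for the smaller [v]; for [m] itself nothing is required there. *)
    have okq : eventually_in B1 (fun n => forall v, v \in q ->
        b v n <= b m n /\ ok v n (b m n) (s n)).
      apply: ev_seq => v vq; have vm := mmax v vq.
      apply: ev_and; first exact: b_le.
      case: vm => [->|vm]; first by apply: evT => n _ e be; rewrite ltnNge be.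
      apply: ev_mono2 (sP m mw) (ev_sub B1B (ev_and Qs (Qo v vm))) => n _.
      by move=> pre [sz]; apply: ok_prefix => //; rewrite sz.
    apply: ev_mono2 okq Gq => n _ okn [x Gx]; exists (b m n, x) => v vq.
    by have [? ?] := okn v vq; split=> //; exact: Gx.
  have CB := ev_sub CB1 B1B.
  (* The inner [take] keeps the part of [s n] known to be correct, the new value is repeated after
     it, and the outer [take] fixes the length at [b w n]. *)
  pose y n := take (b w n) (take (ex n).1 (s n) ++ nseq (b w n) (ex n).2).
  have size_y n : size (y n) = b w n.
    rewrite size_take size_cat size_nseq.
    by case: ltnP => //; case: (size _) => [|k]; rewrite ?addSn ?add0n // => h;
       apply/eqP; rewrite eqn_leq h -addSn leq_addl.
  exists C, y; split=> //; split.
  + by apply: evT => n _.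
  + move=> v vw; have [Qs _ _] := IH v vw.
    have H := ev_and (ev_sub CB Qs) (ev_sub CB1 (sP v vw)).
    apply: ev_mono2 (ev_and H (b_lt C vw)) (CX v vw) => n _.
    move=> [[sz /prefixP[z sE]] bvw] [bve _ _]; apply/prefixP.
    have le1 : size (f v n) <= (ex n).1 by rewrite sz.
    rewrite /y sE [take (ex n).1 _]take_cat ltnNge le1 /= -catA take_cat.
    rewrite ltnNge sz ltnW //=.
    by eexists.
  + move=> v vw; apply: ev_mono (CX v vw) => n _ [bve Gx oks] e be ebw _.
    rewrite /y nth_take // nth_cat size_take.
    have [es|es] := ltnP (ex n).1 (size (s n)).
      case: ltnP => [ee|ee].
        by rewrite nth_take //; apply: oks => //; exact: ltn_trans ee es.
      rewrite nth_nseq (leq_ltn_trans (leq_subr _ _) ebw).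
      exact: Ganti (ltnW ebw) Gx.
    case: ltnP => [ee|ee].
      have ex1 : e < (ex n).1 := leq_trans ee es.
      by rewrite nth_take //; apply: oks.
    rewrite nth_nseq (leq_ltn_trans (leq_subr _ _) ebw).
    exact: Ganti (ltnW ebw) Gx.
have [|C [s [Cinf CB sP]]] := @path_bounded _ _ Wp towB _
    (fun x y : seq T => prefix x y) (@prefix_refl T)
    (fun x y z => @prefix_trans T y x z) f B Binf.
  by move=> v w vw; have [_ /(_ v vw)] := fQ w.
exists C, s; split=> [//||v w]; first exact: ev_sub CB BA.
case: (ltwo.2 v w) => [vw|->|wv].
- have [Qs _ Qo] := fQ w.
  apply: ev_mono2 (ev_sub CB (ev_and Qs (Qo v vw))) (sP w) => n _ [sz okv] pre.
  have oks : ok v n (b w n) (s n) by apply: ok_prefix pre _ okv; rewrite sz.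
  move=> e be ebw; apply: oks => //.
  by apply: leq_trans ebw _; rewrite -sz; exact: size_prefix.
- by apply: evT => n _ e be; rewrite ltnNge be.
- apply: ev_mono (b_lt C wv) => n _ bwv e be ebw.
  by have := ltn_trans (leq_ltn_trans be ebw) bwv; rewrite ltnn.
Qed.

(** The functions [M j] are not assumed to be comparable with each other, so that only the
    cardinality of [D] matters, as [fillable_le] shows. *)
Definition fillable (D : set W) : Prop := forall (A : set nat) M,
  unbounded_nat A ->
  (forall w j, D j -> eventually_in A (fun n => b w n <= M j n)) ->
  exists B l, [/\ unbounded_nat B, eventually_in B A,
    forall w, eventually_in B (fun n => b w n <= l n) &
    forall j, D j -> eventually_in B (fun n => l n <= M j n)].

Lemma fillable_set0 : fillable set0.
Proof.
move=> A M Ainf _; have [g Hg] := dominating Wp towB b.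
exists A, g; split=> // [|w]; first exact: ev_refl.
by apply: ev_sub (Hg w); exact: evT.
Qed.

Lemma fillable_le D E : D #<= E -> fillable E -> fillable D.
Proof.
move=> /pfcard_geP[->|[g]] fE; first exact: fillable_set0.
move=> A M Ainf bM; have [|B [l [Binf BA bl lM]]] := fE A (M \o g) Ainf.
  by move=> w j Ej; apply: bM; exact: 'funS_g.
exists B, l; split=> // j Dj; have [i Ei <-] := 'surj_g Dj.
exact: lM.
Qed.

Lemma fillable_finite D : finite_set D -> fillable D.
Proof.
move=> /finite_seqP[s ->]; elim: s => [|i s IH].
  by have -> : [set` [::]] = set0 :> set W; [apply/seteqP;
    split|exact: fillable_set0].
move=> A M Ainf bM; have [|B [l [Binf BA bl lM]]] := IH A M Ainf.
  by move=> w j js; apply: bM; rewrite /= inE js orbT.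
exists B, (fun n => minn (l n) (M i n)); split=> // [w|j].
  apply: ev_mono2 (bl w) (ev_sub BA (bM w i _)); last by rewrite /= mem_head.
  by move=> n _ ? ?; rewrite leq_min; apply/andP.
rewrite /= inE => /orP[/eqP->|js]; first by apply: evT => n _; exact: geq_minr.
by apply: ev_mono (lM j js) => n _; apply: leq_trans; exact: geq_minl.
Qed.

(** Stage [j] fills the gap below the earlier [a i], as [fillable (seg lt j)] permits, and takes the
    minimum with [M j]. *)
Lemma decreasing_refinement (D : set W) (A : set nat) M :
  (forall i j, D j -> lt i j -> D i) ->
  (forall j, D j -> fillable (seg lt j)) -> unbounded_nat A ->
  (forall w j, D j -> eventually_in A (fun n => b w n <= M j n)) ->
  exists B a, [/\ unbounded_nat B, eventually_in B A,
    forall w j, D j -> eventually_in B (fun n => b w n <= a j n),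
    forall j, D j -> eventually_in B (fun n => a j n <= M j n) &
    forall i j, D j -> lt i j -> eventually_in B (fun n => a j n <= a i n)].
Proof.
move=> Ddown fillD Ainf bM.
pose Q j (B : set nat) (f : W -> nat -> nat) (x : nat -> nat) := D j ->
  [/\ forall w, eventually_in B (fun n => b w n <= x n),
    eventually_in B (fun n => x n <= M j n) &
    forall i, lt i j -> eventually_in B (fun n => x n <= f i n)].
have [|||B [a [Binf BA aQ]]] :=
  @shrinking_choice _ _ Wp towB _ (fun=> 0) Q A _ _ _ Ainf.
- move=> j B f g x fg Qx Dj; have [bx xM xf] := Qx Dj; split=> // i ij.
  by rewrite -fg //; exact: xf.
- move=> j B C f x CB Qx Dj; have [bx xM xf] := Qx Dj.
  by split=> [w||i ij]; [exact: ev_sub CB (bx w)|exact: ev_sub CB xM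
                       |exact: ev_sub CB (xf i ij)].
- move=> j B f Binf BA IH; have [Dj|nDj] := pselect (D j); last first.
    by exists B, (fun=> 0); split=> //; exact: ev_refl.
  have [|C [l [Cinf CB bl lf]]] := fillD j Dj B f Binf.
    by move=> w i ij; have [] := IH i ij (Ddown i j Dj ij).
  exists C, (fun n => minn (l n) (M j n)); split=> // _; split.
  + move=> w; apply: ev_mono2 (bl w) (ev_sub CB (ev_sub BA (bM w j Dj))).
    by move=> n _ ? ?; rewrite leq_min; apply/andP.
  + by apply: evT => n _; exact: geq_minr.
  + move=> i ij; apply: ev_mono (lf i ij) => n _; apply: leq_trans.
    exact: geq_minl.
exists B, a; split=> // [w j Dj|j Dj|i j Dj ij];
  have [bx xM xf] := aQ j Dj => //.
exact: xf.
Qed.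

(* Intervals [[b w n, a w n]] shrink as [w] grows, and nonempty intervals are
   asked to be refined by nonempty ones only. *)
Lemma fillable_setT : (forall u, fillable (seg lt u)) -> fillable setT.
Proof.
move=> fill A M Ainf bM.
have [B [a [Binf BA ba aM adec]]] :=
  @decreasing_refinement setT A M (fun _ _ _ _ => I) (fun j _ =>
    fill j) Ainf bM.
pose R (x y : nat * nat) :=
  [&& x.1 <= y.1, y.2 <= x.2 & (x.1 <= x.2) ==> (y.1 <= y.2)].
have Rrefl x : R x x by rewrite /R !leqnn implybb.
have Rtrans x y z : R x y -> R y z -> R x z.
  case: x y z => [x x'] [y y'] [z z'] /and3P[/= xy yx xx] /and3P[/= yz zy yy].
  apply/and3P; split=> /=; [exact: leq_trans yz|exact: leq_trans yx|].
  by apply/implyP => /(implyP xx)/(implyP yy).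
have [|C [t [Cinf CB tP]]] := @path_bounded _ _ Wp towB _ R Rrefl Rtrans
    (fun w n => (b w n, a w n)) B Binf.
  move=> v w vw; apply: ev_mono2 (ev_and (b_lt B vw) (adec v w I vw)) (ba w w
    I).
  move=> n _ [bvw awv] bw; apply/and3P; split=> //=; first exact: ltnW.
  by rewrite bw implybT.
(* The lower end of the bounding interval lies below [a w n] because that interval is nonempty. *)
exists C, (fun n => (t n).1); split=> // [|w|w _].
- exact: ev_sub CB BA.
- by apply: ev_mono (tP w) => n _ /and3P[].
- apply: ev_mono2 (tP w) (ev_sub CB (ev_and (ba w w I) (aM w I))).
  move=> n _ /and3P[/= _ ta /implyP H] [ba' aM'].
  by apply: leq_trans (H ba') _; exact: leq_trans ta aM'.
Qed.

(* For increasing lengths, [p g n] is a finite sequence which codes the values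
   [c g v n] for all [v] below [g]. *)
Lemma coding_points (c : W -> W -> nat -> nat) (A : set nat) :
  unbounded_nat A ->
  exists B (p : W -> nat -> seq nat), [/\ unbounded_nat B, eventually_in B A &
    forall v g, lt v g -> eventually_in B (fun n =>
      size (p v n) < size (p g n) /\
      nth 0 (p g n) (size (p v n)) = c g v n)].
Proof.
move=> Ainf.
(* The length of [f v n] is the address at which [x] stores [c g v n]. As lengths increase with the
   index, addresses eventually do not clash. *)
pose X (f : W -> nat -> seq nat) g v n (x : seq nat) :=
  size (f v n) < size x /\ nth 0 x (size (f v n)) = c g v n.
pose Q g (B : set nat) (f : W -> nat -> seq nat) (x : nat -> seq nat) :=
  forall v, lt v g -> eventually_in B (fun n => X f g v n (x n)).
have [|||B [p [Binf BA pQ]]] :=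
  @shrinking_choice _ _ Wp towB _ (fun=> [::]) Q A _ _ _ Ainf.
- by move=> g B f h x fh Qx v vg; rewrite /X -fh //; exact: Qx.
- by move=> g B C f x CB Qx v vg; exact: ev_sub CB (Qx v vg).
- move=> g B f Binf _ IH.
  apply: (@saturation _ _ Wp W (seg lt g) _ (X f g) B) => //.
    exact: p_order_seg Wp _.
  move=> q qg.
  have inj : eventually_in B (fun n => forall v, v \in q -> forall w, w \in q ->
      size (f v n) = size (f w n) -> v = w).
    apply: ev_seq => v vq; apply: ev_seq => w wq.
    case: (ltwo.2 v w) => [vw|->|wv]; last 1 first.
    + apply: ev_mono (IH v (qg v vq) w wv) => n _ [lt_s _] eq_s.
      by rewrite eq_s ltnn in lt_s.
    + apply: ev_mono (IH w (qg w wq) v vw) => n _ [lt_s _] eq_s.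
      by rewrite eq_s ltnn in lt_s.
    + exact: evT.
  apply: ev_mono inj => n _ inj.
  pose sizes := [seq size (f v n) | v <- q].
  exists (mkseq (fun i => c g (nth g q (index i sizes)) n) (sumn sizes).+1) => v
    vq.
  have vs : size (f v n) \in sizes by apply/mapP; exists v.
  have le_s : size (f v n) <= sumn sizes := mem_leq_sumn vs.
  split; first by rewrite size_mkseq.
  rewrite nth_mkseq //; congr (c g _ n).
  have iq : index (size (f v n)) sizes < size q.
    by rewrite -(size_map (fun v => size (f v n)) q) index_mem.
  apply: inj => //; first exact: mem_nth.
  by rewrite -(nth_map _ 0 (fun v => size (f v n))) // nth_index.
by exists B, p; split=> // v g; exact: pQ.
Qed.

(** * Gaps whose upper side is infinite and smaller than [W] *)

Section SmallGap.
Context (u : W).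
Let D : set W := seg lt u.
Hypothesis D_inf : infinite_set D.
Hypothesis D_initial : forall v, lt v u -> ~ (D #<= seg lt v).
(** With kappa the cardinality of [D], this initial segment plays the role of kappa^+. *)
Let Theta : set W := [set g | seg lt g #<= D].

(** If [Theta] is all of [W], then [D] would not be small; otherwise the least [g] outside [Theta]
    would have at most kappa predecessors and belong to it. *)
Lemma not_Theta_le : ~ (Theta #<= D).
Proof.
move=> ThD; have [all|nall] := pselect (forall g, Theta g).
  apply: (@p_order_seg _ _ Wp u); apply: card_le_trans ThD.
  by apply: subset_card_le => g _; exact: all.
have [g0 ng0] : exists g, ~ Theta g by apply/existsNP.
have [g ng gmin] := wo_min ltwo (ex_intro (fun x => (~` Theta) x) g0 ng0).
apply: ng; apply: card_le_trans ThD; apply: subset_card_le => x xg.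
by apply: contrapT => nx; exact: gmin x xg nx.
Qed.

(** A fibre of [j] over [i] with more than kappa elements has a member [g] with kappa predecessors
    in the fibre, and [e g] injects these into [seg lt i], against [D_initial]. So [Theta] is a
    union of kappa fibres of size at most kappa, and Hessenberg's theorem applies. *)
Lemma pressing_contradiction (e : W -> W -> W) (j : W -> W) :
  (forall g v w, Theta g -> lt v g -> lt w g -> e g v = e g w -> v = w) ->
  (forall g, Theta g -> D (j g)) ->
  (forall v g, Theta v -> Theta g -> lt v g -> j v = j g -> lt (e g v) (j g)) ->
  False.
Proof.
move=> einj jD ej.
pose Th i : set W := [set g | Theta g /\ j g = i].
have ThD i : Th i #<= D.
  have [//|[g [Thg jg] small]] := card_le_or_seg ltwo (Th i) D.
  have Di : D i by rewrite -jg; exact: jD.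
  case: (D_initial Di); apply: card_le_trans small _.
  apply: card_le_injP; exists (e g);
    split=> [v [vg [Thv jv]]|v w [vg _] [wg _]].
    by rewrite /seg /= -jg; apply: ej => //; rewrite jv jg.
  exact: einj.
have /choice[h hP] : forall i, exists h : W -> W, (forall g,
  Th i g -> D (h g)) /\
    forall v w, Th i v -> Th i w -> h v = h w -> v = w.
  by move=> i; exact: (card_le_inj u (ThD i)).
apply: not_Theta_le; apply: card_le_trans (hessenberg ltwo D_inf).
apply: card_le_injP; exists (fun g => (j g, h (j g) g));
  split=> [g Tg|v w Tv Tw].
  by split; [exact: jD|apply: (hP (j g)).1].
move=> [jvw]; rewrite jvw => /((hP (j w)).2 v w); apply; split=> //.
Qed.

(** Without a filler, each [g] in [Theta] has some [j g] in [D] such that [p g n] stays in the sets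
    listed by [s n] through index [(a (j g) n).+1]. If [lt v g] and [j v = j g], the set at that
    index contains both points, so the coded [a (e g v) n] exceeds [a (j g) n]. As [a] decreases,
    [lt (e g v) (j g)], which [pressing_contradiction] excludes. *)
Lemma fillable_initial_seg : (forall v, lt v u -> fillable (seg lt v)) ->
  fillable D.
Proof.
move=> fill A0 M A0inf bM.
have Ddown i j : D j -> lt i j -> D i by move=> ju ij;
  exact: (wo_trans ltwo ij ju).
have [A [a [Ainf AA0 ba aM adec]]] := decreasing_refinement Ddown fill A0inf bM.
apply: contrapT => nfill.
have {}nfill B l : unbounded_nat B -> eventually_in B A ->
    (forall w, eventually_in B (fun n => b w n <= l n)) ->
    (forall j, D j -> eventually_in B (fun n => l n <= a j n)) -> False.
  move=> Binf BA bl la; apply: nfill; exists B, l; split=> //.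
    exact: ev_sub BA AA0.
  move=> j Dj; apply: ev_mono2 (la j Dj) (ev_sub BA (aM j Dj)) => n _.
  exact: leq_trans.
have [j0 Dj0] := infinite_setN0 D_inf.
have /choice[e eP] : forall g, exists e : W -> W, Theta g ->
    (forall v, lt v g -> D (e v)) /\
    forall v w, lt v g -> lt w g -> e v = e w -> v = w.
  move=> g; have [Tg|nTg] := pselect (Theta g); last by exists id.
  by have [e eP] := card_le_inj u Tg; exists e.
have Tdown v g : Theta g -> lt v g -> Theta v.
  by move=> Tg vg; apply: card_le_trans Tg;
    apply/subset_card_le/(seg_sub ltwo vg).
have [A1 [p [A1inf A1A pP]]] := coding_points (fun g v => a (e g v)) Ainf.
pose C l (x : seq (seq nat)) := forall r t, r \in x -> t \in x ->
  size r < size t -> l <= nth 0 t (size r).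
pose G v n l x := (Theta v -> p v n \in x) /\ C l x.
have [||A2 [s [A2inf A2A1 sP]]] := @internal_sequence _ [::] G A1 A1inf.
- move=> v n l l' x ll' [px Cx]; split=> // r t rx tx rt.
  exact: leq_trans ll' (Cx r t rx tx rt).
- move=> q w.
  have H : eventually_in A1 (fun n => forall v, v \in q -> forall g, g \in q ->
      Theta v -> Theta g -> size (p v n) < size (p g n) ->
      b w n <= nth 0 (p g n) (size (p v n))).
    apply: ev_seq => v vq; apply: ev_seq => g gq.
    have [Tg|nTg] := pselect (Theta g); last by apply: evT.
    case: (ltwo.2 v g) => [vg|->|gv].
    + have De := (eP g Tg).1 v vg.
      apply: ev_mono2 (pP v g vg) (ev_sub A1A (ba w _ De)) => n _.
      by move=> [_ ->].
    + by apply: evT => n _ _ _; rewrite ltnn.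
    + apply: ev_mono (pP g v gv) => n _ [gv_n _] _ _ vg_n.
      by have := ltn_trans gv_n vg_n; rewrite ltnn.
  apply: ev_mono H => n _ H; exists [seq p v n | v <- q & `[< Theta v >]] =>
    v vq.
  split=> [Tv|r t]; first by apply/mapP; exists v => //;
    rewrite mem_filter vq andbT; apply/asboolP.
  move=> /mapP[x + ->] /mapP[y + ->].
  rewrite !mem_filter => /andP[/asboolP Tx xq] /andP[/asboolP Ty yq].
  exact: H.
have A2A := ev_sub A2A1 A1A.
pose good v n l := forall i, b v n <= i -> i < l -> G v n i (nth [::] (s n) i).
(* [good] concerns indices below its bound, so [.+2] includes the index [(a j n).+1], which yields a
   strict inequality with [a j n]. *)
pose Q v (B : set nat) (_ : W -> W) (j : W) := Theta v ->
  D j /\ eventually_in B (fun n => good v n (a j n).+2).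
have [|||A3 [j [A3inf A3A2 jP]]] :=
  @shrinking_choice _ _ Wp towB _ u Q A2 _ _ _ A2inf.
- by [].
- move=> v B B' f j BB' Qj Tv; have [Dj gj] := Qj Tv; split=> //.
  exact: ev_sub BB' gj.
- move=> v B ? Binf BA2 _.
  have [[j [Dj jinf]]|nj] := pselect (exists j, D j /\
      unbounded_nat (fun n => B n /\ good v n (a j n).+2)).
    exists (fun n => B n /\ good v n (a j n).+2), j; split=> //.
      by apply: evT => n [].
    by move=> _; split=> //; apply: evT => n [].
  have BA := ev_sub BA2 A2A.
  (* otherwise the predecessor of the last good value fills the gap *)
  have bad i : D i -> eventually_in B (fun n => ~ good v n (a i n).+2).
    move=> Di; apply: contrapT => nev; apply: nj; exists i; split=> // N.
    apply: contrapT => nex; apply: nev; exists N => n Nn Bn gn.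
    by apply: nex; exists n.
  have /choice[l lP] : forall n, exists m, [/\ m <= (a j0 n).+2, good v n m &
      forall k, k <= (a j0 n).+2 -> good v n k -> k <= m].
    by move=> n; apply: exists_last => i _; rewrite ltn0.
  (* The predecessor stays above [b w n] because [b w n < b w' n <= l n], and below [a i n] because
     goodness fails at [(a i n).+2]. The index [j0] only makes the search for [l n] finite. *)
  exfalso; apply: (@nfill B (fun n => (l n).-1)) => // [w|i Di].
    have [w' ww'] := W_nomax Wp w.
    apply: ev_mono2 (ev_sub BA (ba w' j0 Dj0))
      (ev_and (b_lt B ww') (ev_sub BA2 (sP v w'))) => n _ bj0 [bww' gw'].
    have [_ _ lmax] := lP n.
    have : b w' n <= l n by apply: lmax => //; do 2 apply: leqW.
    move=> /(leq_trans bww'); by case: (l n).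
  apply: ev_mono (bad i Di) => n _ badi; rewrite leqNgt; apply/negP => il.
  apply: badi => k bk ki; have [_ gl _] := lP n; apply: gl => //.
  apply: leq_trans ki _; move: il; by case: (l n).
have A3A := ev_sub A3A2 A2A.
apply: (@pressing_contradiction e j) => [g v w Tg|g Tg|v g Tv Tg vg jvg].
- by have [_] := eP g Tg; exact.
- by have [] := jP g Tg.
have [Dj gv] := jP v Tv; have [_ gg] := jP g Tg; rewrite jvg in gv Dj.
have De := (eP g Tg).1 v vg.
have contra : eventually_in A3 (fun n => a (e g v) n <= a (j g) n) -> False.
  move=> le_a; have := ev_unbounded 0 A3inf (ev_and (ev_and le_a
    (ev_sub A3A2 (ev_sub A2A1 (pP v g vg)))) (ev_and
    (ev_and (ev_sub A3A (ba v _ Dj)) (ev_sub A3A (ba g _ Dj))) (ev_and gv gg))).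
  move=> [n [_ _ [[le_an [sz nthE]] [[bv bg] [gvn ggn]]]]].
  have [pv _] := gvn (a (j g) n).+1 (leqW bv) (ltnSn _).
  have [pg Cn] := ggn (a (j g) n).+1 (leqW bg) (ltnSn _).
  have := Cn _ _ (pv Tv) (pg Tg) sz.
  by rewrite nthE ltnNge le_an.
case: (ltwo.2 (e g v) (j g)) => [//|eE|je]; case: contra.
  by rewrite eE; exact: evT.
exact: ev_sub A3A (adec _ _ De je).
Qed.
End SmallGap.

(** Induction on [u]: the segment injects into an earlier one, is finite, or is an infinite initial
    ordinal. *)
Lemma fillable_seg u : fillable (seg lt u).
Proof.
elim/(well_founded_ind ltwo.1): u => u IH.
have [[v [vu le]]|nle] := pselect (exists v, lt v u /\ seg lt u #<= seg lt v).
  exact: fillable_le le (IH v vu).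
have [fin|inf] := pselect (finite_set (seg lt u)); first exact: fillable_finite.
apply: fillable_initial_seg => // v vu le.
by apply: nle; exists v.
Qed.

(* [s n] lists elements [>= n], the part of it between [b v n] and any [b w n]
   lying in [h v]; an index which fills the gap between the [b w] and the
   lengths up to which this remains true picks an element for all [v] at once. *)
Lemma family_bounded (h : W -> set nat) :
  (forall q : seq W, unbounded_nat (fun n => forall v, v \in q -> h v n)) ->
  exists2 A, unbounded_nat A & forall w, eventually_in A (h w).
Proof.
move=> hfip.
pose G (v : W) (n l x : nat) := h v x /\ n <= x.
have Tinf : unbounded_nat setT by move=> N; exists N.
have [||A [s [Ainf _ sP]]] := @internal_sequence _ 0 G setT Tinf.
- by [].
- move=> q w; apply: evT => n _; have [x nx hx] := hfip q n.
  by exists x => v vq; split=> //; exact: hx.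
pose good v n l := forall i, b v n <= i -> i < l -> G v n i (nth 0 (s n) i).
have [g gP] := dominating Wp towB b.
have /choice[M MP] : forall v, exists M : nat -> nat, forall n,
  good v n (M n) /\
    forall k, k <= g n -> good v n k -> k <= M n.
  move=> v; have /choice[m mP] : forall n, exists m, [/\ m <= g n, good v n m &
      forall k, k <= g n -> good v n k -> k <= m].
    by move=> n; apply: exists_last => i _; rewrite ltn0.
  by exists m => n; have [_] := mP n.
have [|B [l [Binf BA bl lM]]] := fillable_setT fillable_seg (M := M) Ainf.
  move=> w v _.
  apply: ev_mono2 (sP v w) (ev_sub (evT (fun n _ => I)) (gP w)) => n _ gw bg.
  by apply: (MP v n).2.
(* Goodness up to [l n] concerns the indices below it, hence the predecessor; it is at least [b v n]
   since [b v n < b w n <= l n] for a later [w]. *)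
pose x n := nth 0 (s n) (l n).-1.
have xP v : eventually_in B (fun n => h v (x n) /\ n <= x n).
  have [w vw] := W_nomax Wp v.
  apply: ev_mono2 (ev_and (b_lt B vw) (bl w)) (lM v I) => n _ [bvw bw] lm.
  have lpos : b v n < l n := leq_trans bvw bw.
  apply: ((MP v n).1 (l n).-1); first by case: (l n) lpos.
  by apply: leq_trans lm; case: (l n) lpos.
have [w0 _] := W_inhabited Wp.
exists (x @` B).
  move=> N; have [n [Nn Bn [_ nx]]] := ev_unbounded N Binf (xP w0).
  by exists (x n); [exact: leq_trans nx|exists n].
move=> w; have [N HN] := xP w; have [K HK] := exists_bound x N.
exists K => z Kz [n Bn nE]; rewrite -nE in Kz *.
have [|//] := HN n _ Bn.
by rewrite leqNgt; apply/negP => /HK; rewrite ltnNge Kz.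
Qed.

End Gaps.

(** * A well-order of type p and an unbounded tower along it *)

Definition lacks_pseudo_intersection (H : set (set nat)) : Prop :=
  strong_fip H /\ ~ exists2 A, infinite_set A & lower_bound_of H A.

Lemma exists_strict_wo (T : eqType) : exists lt : T -> T -> Prop, strict_wo lt.
Proof.
have [R Rwo] := well_ordering_principle T.
have [min uniq_min] : (forall P : T -> Prop, (exists x, P x) ->
      exists2 z, P z & forall x, P x -> R z x) /\
    (forall x y, R x x -> R y y -> R x y -> R y x -> x = y).
  split=> [P [x Px]|x y xx yy xy yx].
    have [|z [[zP zmin] _]] := Rwo (fun x => `[< P x >]).
      by exists x; apply/asboolP.
    exists z => [|y Py]; first exact/asboolP.
    by apply: zmin; apply/asboolP.
  have [|z [_ zuniq]] := Rwo (fun z => (z == x) || (z == y)).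
    by exists x; rewrite unfold_in eqxx.
  rewrite -(zuniq x); last first.
    split; first by rewrite unfold_in eqxx.
    by move=> t; rewrite unfold_in => /orP[/eqP->|/eqP->].
  apply: zuniq; split; first by rewrite unfold_in eqxx orbT.
  by move=> t; rewrite unfold_in => /orP[/eqP->|/eqP->].
have Rxx x : R x x.
  by have [|z -> zmin] := min (fun z => z = x); [exists x|exact: zmin].
exists (fun x y => R x y /\ x <> y); split.
  move=> x; apply: contrapT => nx.
  have [|z nz zmin] := min (fun x => ~ Acc (fun x y => R x y /\ x <> y) x).
    by exists x.
  apply: nz; constructor=> y [yz neq]; apply: contrapT => /zmin zy.
  exact/neq/uniq_min.
move=> x y; have [->|/eqP xy] := eqVneq x y; first exact: Or32.
have [|z zxy zmin] := min (fun z => z = x \/ z = y); first by exists x; left.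
case: zxy zmin => -> zmin.
  by apply: Or31; split=> //; apply: zmin; right.
by apply: Or33; split; [apply: zmin; left|exact: nesym].
Qed.

(** A free ultrafilter is such a family: an infinite [A] splits into two infinite parts by the set
    [E], and [A] is almost contained neither in [E] nor in its complement, one of which is in the
    ultrafilter. *)
Lemma exists_lacks_pseudo_intersection : exists H, lacks_pseudo_intersection H.
Proof.
have [U [UU ooU]] := ultraFilterLemma eventually_filter.
have Uinf A : U A -> infinite_set A.
  move=> UA /finite_set_nat_bounded[N AN].
  apply: (@filter_not_empty _ U _).
  have : U [set n | N <= n] by apply: ooU; exists N.
  move/(filterI UA); apply: filterS => n [/AN]; rewrite ltnNge => /negP nNn.
  exact: nNn.
exists U; split.
  move=> F /finite_seqP[s ->] sU; apply: Uinf.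
  elim: s sU => [|B s IH] sU.
    by rewrite [X in U X](_ : _ = setT) ?set_nil ?bigcap_set0 //;
      exact: filterT.
  have UB : U B by apply: sU; rewrite /= mem_head.
  have Us : U (\bigcap_(B in [set` s]) B).
    by apply: IH => C Cs; apply: sU; rewrite /= inE (Cs : C \in s) orbT.
  apply: filterS (filterI UB Us) => n [Bn sn] C /=.
  by rewrite inE => /orP[/eqP->|/sn].
move=> [A Ainf Alb].
have /(card_le_inj 0)[g [gA ginj]] := (infiniteP A).1 Ainf.
have split_A (P : nat -> Prop) (f : nat -> nat) : injective f ->
    (forall n, ~ P (g (f n))) -> ~ U [set x | P x].
  move=> finj nP /Alb fin.
  have : [set: nat] #<= A `\` [set x | P x].
    apply: card_le_injP; exists (g \o f); split=> [n _|n m _ _ /= gfe].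
      by split; [exact: gA|exact: nP].
    by apply: finj; exact: ginj.
  by move=> /infiniteP.
pose E : set nat := [set x | exists n, x = g n.*2].
have gE n : E (g n.*2) by exists n.
have gO n : ~ E (g n.*2.+1).
  move=> [m /ginj - /(_ I I) /(congr1 odd)].
  by rewrite /= !odd_double.
have [UE|UE] := in_ultra_setVsetC E UU.
  apply: (split_A E (fun n => n.*2.+1)) => //.
  by move=> n m [/double_inj].
apply: (split_A (fun x => ~ E x) (fun n => n.*2)) => // [|n]; last exact.
exact: double_inj.
Qed.

(** Diagonal choice of [x n >= n] in the first [n.+1] sets. It makes p uncountable. *)
Lemma countable_pseudo_intersection (H : set (set nat)) : countable H ->
  strong_fip H -> exists2 A, infinite_set A & lower_bound_of H A.
Proof.
move=> /pfcard_geP[-> _|[f] fipH].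
  by exists setT; [exact: infinite_nat|].
have /choice[x xP] : forall n, exists k,
    n <= k /\ forall i, i <= n -> (f : nat -> set nat) i k.
  move=> n; have fH : f @` `I_n.+1 `<=` H by move=> _ [i _ <-]; exact: 'funS_f.
  have [k nk fk] := (infinite_set_natP _).1
    (fipH _ (finite_image f (finite_II n.+1)) fH) n.
  by exists k; split=> // i ile; apply: fk; exists i.
exists (range x).
  apply/infinite_set_natP => N; exists (x N); last by exists N.
  exact: (xP N).1.
move=> B HB; have [i _ <-] := 'surj_f HB.
apply/almost_subsetP; have [N HN] := exists_bound x i.
exists N => z Nx [n _ nE]; rewrite -nE in Nx *; apply: (xP n).2.
by rewrite leqNgt; apply/negP => /HN; rewrite ltnNge Nx.
Qed.

(** In a well-order of [set nat], [D] is the shortest initial segment into which a family without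
    pseudo-intersection injects, or everything if no proper one will do; [W] is [D] as a type. *)
Lemma exists_p_order : exists (W : choiceType) (lt : W -> W -> Prop),
  p_order lt /\ exists h : W -> set nat, lacks_pseudo_intersection (range h).
Proof.
have [lt ltwo] := exists_strict_wo (set nat).
have [H0 badH0] := exists_lacks_pseudo_intersection.
have [D [[H badH HD] Dmin Ddown]] : exists D : set (set nat),
    [/\ exists2 H, lacks_pseudo_intersection H & H #<= D,
      forall v H, D v -> lacks_pseudo_intersection H -> ~ (H #<= seg lt v) &
      forall v w, D w -> lt v w -> D v].
  pose P u := exists2 H, lacks_pseudo_intersection H & H #<= seg lt u.
  have [[u Pu]|nP] := pselect (exists u, P u).
    have [m Pm mmin] := wo_min ltwo (ex_intro P u Pu).
    exists (seg lt m); split=> // [v H vm badH Hv|v w wm vw].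
      by apply: mmin vm _; exists H.
    exact: (wo_trans ltwo vw wm).
  exists setT; split=> //; first by exists H0; [|exact: card_leT].
  by move=> v H _ badH Hv; apply: nP; exists v, H.
have HinfD : forall H', lacks_pseudo_intersection H' -> D #<= H'.
  move=> H' badH'; have [//|[v Dv small]] := card_le_or_seg ltwo D H'.
  case: (Dmin v H' Dv badH'); apply: card_le_trans small _.
  by apply: subset_card_le => x [].
pose W : choiceType := D : Type.
pose ltW (x y : W) := lt (val x) (val y).
have WD : [set: W] #= D by exact: card_setT.
have ltWwo : strict_wo ltW.
  split=> [x|x y].
    have [a xa] : exists a, val x = a by exists (val x).
    elim/(well_founded_ind ltwo.1): a x xa => a IH x xa.
    by constructor=> y yx; apply: (IH (val y)) => //; rewrite -xa.
  case: (ltwo.2 (val x) (val y)) => [?|/val_inj ?|?];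
    [exact: Or31|exact: Or32|exact: Or33].
exists W, ltW; split; last first.
  have : H #<= [set: W] by rewrite (card_le_eqr WD).
  move=> /pfcard_geP[H00|[h]].
    case: badH => _ []; exists setT; first exact: infinite_nat.
    by rewrite H00.
  exists h; suff -> : range h = H by [].
  by apply/seteqP; split=> [_ [w _ <-]|B HB]; [exact: 'funS_h|exact: 'surj_h].
split=> //.
- rewrite (eq_countable WD) => cD.
  have [fipH []] := badH; apply: countable_pseudo_intersection fipH.
  exact: sub_countable HD cD.
- move=> w; rewrite /small (card_le_eql WD) => Dw.
  have Dvw : D (val w) by apply: set_mem; exact: (valP w).
  apply: (Dmin _ H Dvw badH); apply: card_le_trans HD _.
  apply: card_le_trans Dw _; apply: card_le_injP; exists val.
  by split=> // x y _ _ /val_inj.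
- move=> H'; rewrite /small (card_le_eql WD) => nDH' fipH'.
  by apply: contrapT => npi; apply: nDH'; exact: HinfD.
Qed.

(** This is the core of p = t: were all towers bounded, [family_bounded] would give a
    pseudo-intersection of [h]. *)
Lemma exists_unbounded_tower : exists (W : choiceType) (lt : W -> W -> Prop),
  p_order lt /\ ~ towers_bounded lt.
Proof.
have [W [lt [Wp [h [fiph nh]]]]] := exists_p_order.
exists W, lt; split=> // towB; have [b b_incr] := increasing_functions Wp towB.
have [|A /infinite_set_natP Ainf Ah] := family_bounded Wp towB b_incr (h := h).
  move=> q; apply/infinite_set_natP.
  have := fiph [set h w | w in [set` q]] (finite_image _ (finite_seq q)).
  move=> /(_ (fun _ '(ex_intro2 w _ e) => ex_intro2 _ _ w I e)).
  apply: sub_infinite_set => n hn v vq; apply: hn; by exists v.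
apply: nh; exists A => // _ [w _ <-].
by apply/almost_subsetP.
Qed.

(** * Semifilters that are G_delta sets *)

Section GdeltaSemifilter.
Context (G : set (set nat)) (semifilterG : semifilter G).

Lemma semifilter_up A B : G A -> eventually_in A B -> G B.
Proof. by have [_ _ up] := semifilterG => GA /almost_subsetP; exact: up GA. Qed.

Lemma semifilter_setT : G setT.
Proof.
have [[A GA] _ _] := semifilterG.
by apply: semifilter_up GA _; exact: evT.
Qed.

Lemma semifilter_unbounded A : G A -> unbounded_nat A.
Proof.
move=> GA; apply/infinite_set_natP => finA; have [_ + up] := semifilterG.
apply; apply/seteqP; split=> // B _; apply: up GA _.
exact: finite_setD.
Qed.

(** By compactness counterexamples [x N] cluster at some [p]. Each [n] in [A] is in almost all
    [x N], hence in [p]; so [p] is in [U], while all [x N] avoid this open set. *)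
Lemma open_finite_part (U : set cantor_space) (A : set nat) : open U ->
  (forall x : cantor_space, (forall n, A n -> x n) -> U x) ->
  exists N, forall x : cantor_space, (forall n, n < N -> A n -> x n) -> U x.
Proof.
move=> openU AU; apply: contrapT => nN.
have /choice[x xP] : forall N, exists x : cantor_space,
    (forall n, n < N -> A n -> x n) /\ ~ U x.
  move=> N; apply: contrapT => nx; apply: nN; exists N => x Ax.
  by apply: contrapT => nUx; apply: nx; exists x.
have [|p [_ pcl]] := @cantor_space_compact (x @ \oo) _.
  exact: filterT.
have Up : U p.
  apply: AU => n An; apply: contrapT => /negP npn.
  have : nbhs p [set y : cantor_space | ~~ y n].
    apply: (@proj_continuous nat (fun=> bool) n p [set c : bool | ~~ c]).
    by apply: open_nbhs_nbhs; split=> //; exact: discrete_open.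
  have xn : (x @ \oo) [set y : cantor_space | y n].
    exists n.+1 => // N /= nN'; apply: (xP N).1 => //.
  by move=> /(pcl _ _ xn)[y [/= ->]].
have xU : (x @ \oo) (~` U) by exists 0 => // N _; exact: (xP N).2.
by have [y []] := pcl _ _ xU (open_nbhs_nbhs (conj openU Up)).
Qed.

(** For [G] the intersection of open [U i], [F k a] says that all supersets of [a] lie in [U i] for
    [i <= k]. Density follows from [open_finite_part], applied to the part of [A] from [m] on. *)
Lemma Gdelta_finite_sets : Gdelta (cantor_of G) ->
  exists F : nat -> seq nat -> Prop,
    (forall A k m, G A -> exists2 a, F k a & forall x,
      x \in a -> m <= x /\ A x) /\
    (forall A, (forall N, exists k a, [/\ N <= k, F k a &
      forall x, x \in a -> A x]) -> G A).
Proof.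
move=> [U openU GU].
have GUP (x : cantor_space) : G [set n | x n] <-> forall i, U i x.
  by have := congr1 (fun S => S x) GU; rewrite /cantor_of /bigcap /= => ->;
     split=> [H i|H i _]; exact: H.
exists (fun k a => forall x : cantor_space, (forall n, n \in a -> x n) ->
  forall i, i <= k -> U i x); split=> [A k m GA|A FA].
  have /choice[N NP] : forall i, exists N, forall x : cantor_space,
      (forall n, n < N -> (m <= n /\ A n) -> x n) -> U i x.
    move=> i; apply: (@open_finite_part (U i) (fun n => m <= n /\ A n)) =>
      // x Ax.
    apply: ((GUP x).1 _ i); apply: semifilter_up GA _; exists m => n mn An.
    exact: Ax.
  have [M MP] := exists_bound N k.+1.
  exists [seq n <- iota 0 M | `[< m <= n /\ A n >]] => [x xa i ik|x];
    last first.
    by rewrite mem_filter => /andP[/asboolP].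
  apply: NP => n nN mA; apply: xa; rewrite mem_filter mem_iota /=.
  by rewrite (ltn_trans nN (MP i ik)) andbT; apply/asboolP.
pose x : cantor_space := fun n => `[< A n >].
have -> : A = [set n | x n] by apply/seteqP; split=> n /asboolP.
apply/GUP => i; have [k [a [ik Fa aA]]] := FA i.
by apply: Fa ik => n /aA An; apply/asboolP.
Qed.

Section FiniteSets.
Context (F : nat -> seq nat -> Prop).
Hypothesis F_dense : forall A k m, G A ->
  exists2 a, F k a & forall x, x \in a -> m <= x /\ A x.
Hypothesis F_infinite : forall A, (forall N, exists k a, [/\ N <= k, F k a &
  forall x, x \in a -> A x]) -> G A.

(** Far out in a lower bound of finitely many members there is some [a] with [F n a] contained in
    all of them. Saturation gives one choice [f n] for the whole of [C], and the union of the [f n]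
    over [B] is the bound. *)
Lemma small_centered_bounded (W : choiceType) (lt : W -> W -> Prop) C :
  p_order lt -> centered G C -> small W C -> exists2 A,
    G A & lower_bound_of C A.
Proof.
(* [F n (f n)] will be known only through a member [v0] of [C], so the empty family is treated
   apart. *)
move=> Wp [CG Cfin] smC; have [[v0 Cv0]|C0] := pselect (C !=set0); last first.
  have [//|A GA _] := Cfin set0 (finite_set0 _).
  by exists A => // B CB; case: C0; exists B.
have Tinf : unbounded_nat setT by move=> N; exists N.
pose X (v : set nat) n a := F n a /\ forall x, x \in a -> n <= x /\ v x.
have [|B [f [Binf _ fP]]] :=
  @saturation _ _ Wp (set nat : choiceType) C (seq nat :
    countType) X setT smC Tinf.
  move=> s sC; have [A GA Alb] := Cfin [set` s] (finite_seq s) sC.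
  have [N HN] : eventually_in A (fun n => forall v, v \in s -> v n).
    by apply: ev_seq => v vs; apply/almost_subsetP; exact: Alb.
  apply: evT => n _; have [a Fa aA] := F_dense n (maxn N n) GA.
  exists a => v vs; split=> // x /aA[].
  by rewrite geq_max => /andP[Nx nx] Ax; split=> //; exact: HN.
exists [set x | exists2 n, B n & x \in f n].
  apply: F_infinite => N; have [n [Nn Bn [Fn _]]] := ev_unbounded N Binf (fP _
    Cv0).
  by exists n, (f n); split=> // x xf; exists n.
move=> v Cv; apply/almost_subsetP; have [N HN] := fP v Cv.
have [M HM] := exists_bound (fun n => sumn (f n)) N.
exists M => x Mx [n Bn xf]; have [Nn|nN] := leqP N n.
  by have [_ /(_ x xf)[]] := HN n Nn Bn.
by have := leq_ltn_trans (mem_leq_sumn xf) (HM n nN); rewrite ltnNge Mx.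
Qed.

Lemma disjoint_finite_sets : exists a : nat -> seq nat,
  [/\ forall n, F n (a n), forall n x, x \in a n -> n <= x &
    forall n m x, x \in a n -> x \in a m -> n = m].
Proof.
have /choice[nx0 nx0P] : forall km : nat * nat, exists a, F km.1 a /\
    forall x, x \in a -> km.2 <= x.
  move=> [k m]; have [a Fa aP] := F_dense k m semifilter_setT.
  by exists a; split=> // x /aP[].
pose nx k m := nx0 (k, m).
have nxP k m : F k (nx k m) /\ forall x, x \in nx k m -> m <= x := nx0P (k, m).
(* The set [a n] is chosen from [bd n] on, and [bd n.+1] exceeds the sum of [a n], hence all its
   elements. *)
pose bd := fix bd n := if n is n'.+1 then
  maxn n (maxn (bd n') (sumn (nx n' (bd n'))).+1) else 0.
pose a n := nx n (bd n).
have bdE n : bd n.+1 = maxn n.+1 (maxn (bd n) (sumn (a n)).+1) by [].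
have nbd n : n <= bd n by case: n => // n; rewrite bdE leq_maxl.
have bdS n : bd n <= bd n.+1 by rewrite bdE !leq_max leqnn orbT.
have bdmono n m : n <= m -> bd n <= bd m.
  move=> nm; rewrite -(subnKC nm); elim: (m - n) => [|k IH];
    first by rewrite addn0.
  by rewrite addnS; exact: leq_trans IH (bdS _).
have abd n x : x \in a n -> x < bd n.+1.
  by move=> /mem_leq_sumn xa; rewrite bdE !leq_max !ltnS xa !orbT.
have lt_ne n m x : n < m -> x \in a n -> x \in a m -> False.
  move=> nm /abd xn /(nxP _ _).2 xm.
  have := leq_trans xn (leq_trans (bdmono _ _ nm) xm).
  by rewrite ltnn.
exists a; split=> [n|n x /(nxP _ _).2|n m x xn xm].
- exact: (nxP _ _).1.
- exact: leq_trans.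
- case: (ltngtP n m) => // nm; first by case: (lt_ne n m x).
  by case: (lt_ne m n x).
Qed.

End FiniteSets.
End GdeltaSemifilter.

(** All three cardinals are that of [W]: no competing family is small, and [K], the image of an
    unbounded tower indexed by [W], is an unbounded chain. *)
Theorem theorem3p3 (G : set (set nat)) (semifilterG : semifilter G)
    (GdeltaG : Gdelta (cantor_of G)) :
  exists K : set (set nat),
    [/\ p_number G K, t_number G K & pseudo_intersection_number K].
Proof.
have [F [F_dense F_infinite]] := Gdelta_finite_sets semifilterG GdeltaG.
have [a [Fa age adisj]] := disjoint_finite_sets semifilterG F_dense.
have [W [lt [Wp ntow]]] := exists_unbounded_tower.
have ltwo := p_order_wo Wp.
have [X [Xinf Xdec Xunb]] : exists X : W -> set nat,
    [/\ forall w, unbounded_nat (X w),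
      forall v w, lt v w -> eventually_in (X w) (X v) &
      ~ exists2 B, unbounded_nat B & forall w, eventually_in B (X w)].
  apply: contrapT => nX; apply: ntow => X Xinf Xdec.
  by apply: contrapT => nB; apply: nX; exists X.
pose phi Y : set nat := [set x | exists2 n, Y n & x \in a n].
have phi_G Y : unbounded_nat Y -> G (phi Y).
  move=> Yinf; apply: F_infinite => N; have [n Nn Yn] := Yinf N.
  by exists n, (a n); split=> // x xa; exists n.
have phi_sub Y Z : eventually_in Y Z -> eventually_in (phi Y) (phi Z).
  move=> [N YZ]; have [M HM] := exists_bound (fun n => sumn (a n)) N.
  exists M => x Mx [n Yn xa]; exists n => //; apply: YZ => //.
  rewrite leqNgt; apply/negP => /HM; apply/negP; rewrite -leqNgt.
  exact: leq_trans Mx (mem_leq_sumn xa).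
pose K := range (phi \o X).
have K_chain : almost_chain G K.
  apply: (tower_chain ltwo) => [v w _ _ vw|w _]; last exact: phi_G.
  exact/phi_sub/Xdec.
have Gn0 : G !=set0 by exists setT; exact: semifilter_setT.
have K_unb : unbounded G K.
  move=> [A GA AK]; apply: Xunb.
  have AX w : eventually_in A (phi (X w)).
    by apply/almost_subsetP; apply: AK; exists w.
  (* A bound [A] of [K] is pulled back to the [n] for which [a n] meets [A]. Disjointness of the
     [a n] recovers [n] in [X w] from a point of [phi (X w)]. *)
  exists [set n | exists2 x, x \in a n & A x] => [N|w].
    have [w _] := W_inhabited Wp.
    have [M HM] := exists_bound (fun n => sumn (a n)) N.
    have [x [Mx Ax [n Xn xa]]] :=
      ev_unbounded M (semifilter_unbounded semifilterG GA) (AX w).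
    exists n; last by exists x.
    rewrite leqNgt; apply/negP => /HM; apply/negP; rewrite -leqNgt.
    exact: leq_trans Mx (mem_leq_sumn xa).
  have [N HN] := AX w; exists N => n Nn [x xa Ax].
  have [m Xm xm] := HN x (leq_trans Nn (age n x xa)) Ax.
  by rewrite (adisj n m x xa xm).
have KW : K #<= [set: W] := card_image_le _ _.
have W_centered H : centered G H -> unbounded G H -> [set: W] #<= H.
  move=> cH uH; apply: contrapT => smH; apply: uH.
  exact (small_centered_bounded F_dense F_infinite Wp cH smH).
have W_lacks H : lacks_pseudo_intersection H -> [set: W] #<= H.
  move=> [fipH nH]; apply: contrapT => smH; apply: nH.
  exact (p_order_pseudo_intersection Wp smH fipH).
have X_lacks : lacks_pseudo_intersection (range X).
  split; last first.
    move=> [B /infinite_set_natP Binf Blb]; apply: Xunb; exists B => // w.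
    by apply/almost_subsetP; apply: Blb; exists w.
  by apply: (tower_strong_fip ltwo) => [v w _ _|w _]; [exact: Xdec|exact: Xinf].
have K_centered := chain_centered Gn0 K_chain.
exists K; split; split.
- by exists K.
- by move=> H [cH uH]; exact: card_le_trans KW (W_centered H cH uH).
- by exists K.
- move=> H [cH uH]; apply: card_le_trans KW (W_centered H _ uH).
  exact: chain_centered.
- exists (range X) => //; apply: Cantor_Bernstein.
    exact: card_le_trans (card_image_le _ _) (W_centered K K_centered K_unb).
  exact: card_le_trans KW (W_lacks _ X_lacks).
- by move=> H lacksH; exact: card_le_trans KW (W_lacks H lacksH).
Qed.
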